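(* There exists a braided monoidal equivalence between the categories $3\mathrm{Alg}^{\mathrm K}$ and $3\mathrm{Alg}^{\mathrm H}$ that preserves the corresponding Hopf algebra structures.
   Context: Let $\mathcal C$ be a braided strict monoidal category with tensor product $\otimes$, unit $\mathbf 1$, braiding $c$. For an object $H$ write $\mathrm{id}=\mathrm{id}_H$, $\mathrm{id}_n=\mathrm{id}_{H^{\otimes n}}$, $c=c_{H,H}$. A Hopf algebra in $\mathcal C$ is an object $H$ with morphisms $\mu:H\otimes H\to H$, $\eta:\mathbf 1\to H$, $\Delta:H\to H\otimes H$, $\varepsilon:H\to\mathbf 1$, $S:H\to H$ and $S^{-1}:H\to H$ such that: $\mu(\mu\otimes\mathrm{id})=\mu(\mathrm{id}\otimes\mu)$; $\mu(\eta\otimes\mathrm{id})=\mathrm{id}=\mu(\mathrm{id}\otimes\eta)$; $(\Delta\otimes\mathrm{id})\Delta=(\mathrm{id}\otimes\Delta)\Delta$; $(\varepsilon\otimes\mathrm{id})\Delta=\mathrm{id}=(\mathrm{id}\otimes\varepsilon)\Delta$; $(\mu\otimes\mu)(\mathrm{id}\otimes c\otimes\mathrm{id})(\Delta\otimes\Delta)=\Delta\mu$; $\varepsilon\mu=\varepsilon\otimes\varepsilon$; $\Delta\eta=\eta\otimes\eta$; $\varepsilon\eta=\mathrm{id}_{\mathbf 1}$; $\mu(S\otimes\mathrm{id})\Delta=\eta\varepsilon=\mu(\mathrm{id}\otimes S)\Delta$; $SS^{-1}=\mathrm{id}=S^{-1}S$. The left adjoint action is $\mathrm{ad}=\mu(\mu\otimes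 S)(\mathrm{id}\otimes c)(\Delta\otimes\mathrm{id}):H\otimes H\to H$; it is braided cocommutative if $(\mathrm{ad}\otimes\mathrm{id})(\mathrm{id}\otimes c)(\Delta\otimes\mathrm{id})=c^{-1}(\mathrm{id}\otimes\mathrm{ad})(\Delta\otimes\mathrm{id})$. Consider the following axioms for morphisms $v_+,v_-:\mathbf 1\to H$ and $w:\mathbf 1\to H\otimes H$: (R) $\mu(v_+\otimes\mathrm{id})=\mu(\mathrm{id}\otimes v_+)$; $\mu(v_+\otimes v_-)=\eta$; $\varepsilon v_+=\mathrm{id}_{\mathbf 1}$; $Sv_+=v_+$; $w=(\mu\otimes\mu)(v_-\otimes\mathrm{id}_2\otimes v_-)\Delta v_+$; $(\mathrm{id}\otimes\Delta)w=(\mu\otimes\mathrm{id}_2)(\mathrm{id}\otimes w\otimes\mathrm{id})w$. A Habiro Hopf algebra in $\mathcal C$ is a Hopf algebra $H$ with braided cocommutative left adjoint action, with morphisms $v_\pm:\mathbf 1\to H$, $w:\mathbf 1\to H\otimes H$, $\bar w:H\otimes H\to\mathbf 1$ satisfying (R), $(\mathrm{id}\otimes\bar w)(w\otimes\mathrm{id})=\mathrm{id}$, and $\bar w(\mu\otimes v_+)(v_+\otimes v_+)=\mathrm{id}_{\mathbf 1}$. A Kerler Hopf algebra in $\mathcal C$ is a Hopf algebra $H$ with braided cocommutative left adjoint action, with morphisms $v_\pm:\mathbf 1\to H$, $w:\mathbf 1\to H\otimes H$, $\lambda:H\to\mathbf 1$, $\Lambda:\mathbf 1\to H$ satisfying (R),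 and: $(\mathrm{id}\otimes\lambda)\Delta=\eta\lambda$; $\mu(\Lambda\otimes\mathrm{id})=\Lambda\varepsilon$; $\lambda\Lambda=\mathrm{id}_{\mathbf 1}$; $S\Lambda=\Lambda$; $\lambda S=\lambda$; $(\lambda\otimes\mathrm{id})w=\Lambda$; $\lambda v_+=\mathrm{id}_{\mathbf 1}$. $3\mathrm{Alg}^{\mathrm H}$ (respectively $3\mathrm{Alg}^{\mathrm K}$) is the braided strict monoidal category freely generated by a Habiro (respectively Kerler) Hopf algebra $H$: objects are tensor powers of $H$, morphisms are compositions of tensor products of identities, braidings and structure morphisms, modulo the braided category axioms and the stated axioms. *)

(* Defs.v *)
From mathcomp Require Import all_boot.

Set Implicit Arguments.
Unset Strict Implicit.
Unset Printing Implicit Defensive.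

Declare Scope cat_scope.
Delimit Scope cat_scope with cat.
Declare Scope term_scope.
Delimit Scope term_scope with term.

Reserved Notation "f ≈ g" (at level 70, no associativity).
Reserved Notation "g ∘ f" (at level 40, left associativity).
Reserved Notation "f ⊗ g" (at level 35, right associativity).

(* Hom-sets are setoids: [heq] is equality of morphisms.  Objects form an
   eqType, so that any two proofs of an equality of objects coincide. *)
Record category := Category {
  obj :> eqType;
  hom : obj -> obj -> Type;
  heq : forall a b, hom a b -> hom a b -> Prop;
  idm : forall a, hom a a;
  comp : forall a b c, hom b c -> hom a b -> hom a c;
  heq_refl : forall a b (f : hom a b), heq f f;
  heq_sym : forall a b (f g : hom a b), heq f g -> heq g f;
  heq_trans : forall a b (f g h : hom a b), heq f g -> heq g h -> heq f h;
  comp_heq : forall a b c (g g' : hom b c) (f f' : hom a b),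
    heq g g' -> heq f f' -> heq (comp g f) (comp g' f');
  comp_idl : forall a b (f : hom a b), heq (comp (idm b) f) f;
  comp_idr : forall a b (f : hom a b), heq (comp f (idm a)) f;
  comp_assoc : forall a b c d (h : hom c d) (g : hom b c) (f : hom a b),
    heq (comp h (comp g f)) (comp (comp h g) f)
}.

Arguments hom {_} _ _.
Arguments heq {_ _ _} _ _.
Arguments idm {_} _.
Arguments comp {_ _ _ _} _ _.

Notation "f ≈ g" := (heq f g) : cat_scope.
Notation "g ∘ f" := (comp g f) : cat_scope.
Local Open Scope cat_scope.

(* The identity of [a], typed as a morphism to an object equal to [a]. *)
Definition eqhom (C : category) (a b : C) (e : a = b) : hom a b :=
  match e in _ = b0 return hom a b0 with erefl => idm a end.

(* In a strict monoidal category the tensor product of objects is associative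
   and unital on the nose; corresponding equations between morphisms are stated
   modulo the identities [eqhom].  [br a b] is the braiding c_{a,b} and
   [brV a b] its inverse. *)
Record bsmcat := BSMCat {
  bcat :> category;
  one : bcat;
  tens : bcat -> bcat -> bcat;
  tensA : forall a b c, tens a (tens b c) = tens (tens a b) c;
  tens1l : forall a, tens one a = a;
  tens1r : forall a, tens a one = a;
  tensm : forall a a' b b' : bcat,
    hom a a' -> hom b b' -> hom (tens a b) (tens a' b');
  br : forall a b : bcat, hom (tens a b) (tens b a);
  brV : forall a b : bcat, hom (tens b a) (tens a b);
  tensm_heq : forall (a a' b b' : bcat) (f f' : hom a a') (g g' : hom b b'),
    f ≈ f' -> g ≈ g' -> tensm f g ≈ tensm f' g';
  tensm_id : forall a b : bcat, tensm (idm a) (idm b) ≈ idm (tens a b);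
  tensm_comp : forall (a a' a'' b b' b'' : bcat)
      (f' : hom a' a'') (f : hom a a') (g' : hom b' b'') (g : hom b b'),
    tensm (f' ∘ f) (g' ∘ g) ≈ tensm f' g' ∘ tensm f g;
  tensm_A : forall (a a' b b' c c' : bcat)
      (f : hom a a') (g : hom b b') (h : hom c c'),
    eqhom (tensA a' b' c') ∘ tensm f (tensm g h)
      ≈ tensm (tensm f g) h ∘ eqhom (tensA a b c);
  tensm_1l : forall (a b : bcat) (f : hom a b),
    eqhom (tens1l b) ∘ tensm (idm one) f ≈ f ∘ eqhom (tens1l a);
  tensm_1r : forall (a b : bcat) (f : hom a b),
    eqhom (tens1r b) ∘ tensm f (idm one) ≈ f ∘ eqhom (tens1r a);
  br_brV : forall a b : bcat, br a b ∘ brV a b ≈ idm (tens b a);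
  brV_br : forall a b : bcat, brV a b ∘ br a b ≈ idm (tens a b);
  br_nat : forall (a a' b b' : bcat) (f : hom a a') (g : hom b b'),
    br a' b' ∘ tensm f g ≈ tensm g f ∘ br a b;
  br_hexl : forall a b c : bcat,
    br (tens a b) c ∘ eqhom (tensA a b c)
      ≈ eqhom (esym (tensA c a b)) ∘ tensm (br a c) (idm b)
          ∘ eqhom (tensA a c b) ∘ tensm (idm a) (br b c);
  br_hexr : forall a b c : bcat,
    br a (tens b c)
      ≈ eqhom (tensA b c a) ∘ tensm (idm b) (br a c)
          ∘ eqhom (esym (tensA b a c)) ∘ tensm (br a b) (idm c)
          ∘ eqhom (tensA a b c)
}.

Arguments one {_}.
Arguments tens {_} _ _.
Arguments tensm {_ _ _ _ _} _ _.
Arguments br {_} _ _.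
Arguments brV {_} _ _.
Notation "f ⊗ g" := (tensm f g) : cat_scope.

Record functor (C D : category) := Functor {
  fobj :> C -> D;
  fmap : forall a b : C, hom a b -> hom (fobj a) (fobj b);
  fmap_heq : forall (a b : C) (f g : hom a b), f ≈ g -> fmap f ≈ fmap g;
  fmap_id : forall a : C, fmap (idm a) ≈ idm (fobj a);
  fmap_comp : forall (a b c : C) (g : hom b c) (f : hom a b),
    fmap (g ∘ f) ≈ fmap g ∘ fmap f
}.
Arguments fmap {_ _} _ {_ _} _.

Definition fid (C : category) : functor C C :=
  @Functor C C id (fun _ _ f => f) (fun _ _ _ _ e => e)
    (fun a => heq_refl (idm a)) (fun _ _ _ g f => heq_refl (g ∘ f)).

Lemma fcomp_id (C D E : category) (G : functor D E) (F : functor C D) a :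
  fmap G (fmap F (idm a)) ≈ idm (G (F a)).
Proof.
exact: heq_trans (fmap_heq G (fmap_id F a)) (fmap_id G (F a)).
Qed.

Lemma fcomp_comp (C D E : category) (G : functor D E) (F : functor C D)
    a b c (g : hom b c) (f : hom a b) :
  fmap G (fmap F (g ∘ f)) ≈ fmap G (fmap F g) ∘ fmap G (fmap F f).
Proof.
exact: heq_trans (fmap_heq G (fmap_comp F g f)) (fmap_comp G _ _).
Qed.

Definition fcomp (C D E : category) (G : functor D E) (F : functor C D) :
    functor C E :=
  @Functor C E (fun a => G (F a)) (fun _ _ f => fmap G (fmap F f))
    (fun _ _ _ _ e => fmap_heq G (fmap_heq F e))
    (fcomp_id G F) (fcomp_comp G F).

Definition nat_isomorphic (C D : category) (F G : functor C D) : Prop :=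
  exists (u : forall a : C, hom (F a) (G a))
         (v : forall a : C, hom (G a) (F a)),
  [/\ forall (a b : C) (f : hom a b), u b ∘ fmap F f ≈ fmap G f ∘ u a,
      forall a, v a ∘ u a ≈ idm (F a)
    & forall a, u a ∘ v a ≈ idm (G a)].

Definition is_equivalence (C D : category) (F : functor C D) : Prop :=
  exists G : functor D C,
    nat_isomorphic (fcomp G F) (fid C) /\ nat_isomorphic (fcomp F G) (fid D).

(* Strong rather than strict: [mul_iso] and [one_iso] are the coherence
   isomorphisms F(a) ⊗ F(b) -> F(a ⊗ b) and 1 -> F(1). *)
Record bmfunctor (C D : bsmcat) := BMFunctor {
  bfun :> functor C D;
  mul_iso : forall a b : C, hom (tens (bfun a) (bfun b)) (bfun (tens a b));
  mul_isoV : forall a b : C, hom (bfun (tens a b)) (tens (bfun a) (bfun b));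
  one_iso : hom one (bfun one);
  one_isoV : hom (bfun one) one;
  mul_isoK : forall a b, mul_isoV a b ∘ mul_iso a b ≈ idm _;
  mul_isoVK : forall a b, mul_iso a b ∘ mul_isoV a b ≈ idm _;
  one_isoK : one_isoV ∘ one_iso ≈ idm _;
  one_isoVK : one_iso ∘ one_isoV ≈ idm _;
  mul_iso_nat : forall (a a' b b' : C) (f : hom a a') (g : hom b b'),
    mul_iso a' b' ∘ (fmap bfun f ⊗ fmap bfun g)
      ≈ fmap bfun (f ⊗ g) ∘ mul_iso a b;
  mul_iso_A : forall a b c : C,
    fmap bfun (eqhom (tensA a b c)) ∘ mul_iso a (tens b c)
        ∘ (idm (bfun a) ⊗ mul_iso b c)
      ≈ mul_iso (tens a b) c ∘ (mul_iso a b ⊗ idm (bfun c))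
          ∘ eqhom (tensA (bfun a) (bfun b) (bfun c));
  mul_iso_1l : forall a : C,
    fmap bfun (eqhom (tens1l a)) ∘ mul_iso one a ∘ (one_iso ⊗ idm (bfun a))
      ≈ eqhom (tens1l (bfun a));
  mul_iso_1r : forall a : C,
    fmap bfun (eqhom (tens1r a)) ∘ mul_iso a one ∘ (idm (bfun a) ⊗ one_iso)
      ≈ eqhom (tens1r (bfun a));
  mul_iso_br : forall a b : C,
    fmap bfun (br a b) ∘ mul_iso a b
      ≈ mul_iso b a ∘ br (bfun a) (bfun b)
}.

(* The structure morphisms common to Habiro and Kerler Hopf algebras. *)
Record hopf_structure (C : bsmcat) := HopfStructure {
  hH : C;
  hmu : hom (tens hH hH) hH;
  heta : hom one hH;
  hDelta : hom hH (tens hH hH);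
  heps : hom hH one;
  hS : hom hH hH;
  hSinv : hom hH hH;
  hvp : hom one hH;
  hvm : hom one hH;
  hw : hom one (tens hH hH)
}.

(* F carries the object and the structure morphisms of A to those of B; the
   latter modulo the coherence isomorphisms of F and the identity of H. *)
Definition preserves_hopf_structure (C D : bsmcat) (F : bmfunctor C D)
    (A : hopf_structure C) (B : hopf_structure D) : Prop :=
  exists e : F (hH A) = hH B,
  let p := eqhom e in
  let q := eqhom (esym e) in
  let F2 := mul_iso F (hH A) (hH A) in
  let F0 := one_iso F in
  [/\ p ∘ fmap F (hmu A) ∘ F2 ≈ hmu B ∘ (p ⊗ p),
      p ∘ fmap F (heta A) ∘ F0 ≈ heta B,
      fmap F (hDelta A) ≈ F2 ∘ (q ⊗ q) ∘ hDelta B ∘ p &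
      fmap F (heps A) ≈ F0 ∘ heps B ∘ p]
  /\ [/\ p ∘ fmap F (hS A) ≈ hS B ∘ p,
      p ∘ fmap F (hSinv A) ≈ hSinv B ∘ p,
      p ∘ fmap F (hvp A) ∘ F0 ≈ hvp B,
      p ∘ fmap F (hvm A) ∘ F0 ≈ hvm B &
      fmap F (hw A) ∘ F0 ≈ F2 ∘ (q ⊗ q) ∘ hw B].

(* Formal morphisms over a set of generators [gen m n] of type
   H^{⊗m} -> H^{⊗n}; the object H^{⊗n} is represented by n. *)
Inductive term (gen : nat -> nat -> Type) : nat -> nat -> Type :=
| tgen m n : gen m n -> term gen m n
| tid n : term gen n n
| tcomp l m n : term gen m n -> term gen l m -> term gen l n
| ttens m n p q : term gen m n -> term gen p q -> term gen (m + p) (n + q)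
| tbr m n : term gen (m + n) (n + m)
| tbrV m n : term gen (n + m) (m + n).

Arguments tgen {_ _ _} _.
Arguments tid {_} _.
Arguments tcomp {_ _ _ _} _ _.
Arguments ttens {_ _ _ _ _} _ _.
Arguments tbr {_} _ _.
Arguments tbrV {_} _ _.

Notation "g ∘ f" := (tcomp g f) : term_scope.
Notation "f ⊗ g" := (ttens f g) : term_scope.

Definition trel (gen : nat -> nat -> Type) :=
  forall m n, term gen m n -> term gen m n -> Prop.

Definition tcast gen (m n : nat) (e : m = n) : term gen m n :=
  match e in _ = n0 return term gen m n0 with erefl => tid m end.

(* The congruence generated by the relations [R] and by the axioms of braided
   strict monoidal categories. *)
Section Congruence.
Local Open Scope term_scope.

Inductive teq (gen : nat -> nat -> Type) (R : trel gen) : trel gen :=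
| teq_rel m n (f g : term gen m n) : R m n f g -> teq R f g
| teq_refl m n (f : term gen m n) : teq R f f
| teq_sym m n (f g : term gen m n) : teq R f g -> teq R g f
| teq_trans m n (f g h : term gen m n) : teq R f g -> teq R g h -> teq R f h
| teq_comp l m n (g g' : term gen m n) (f f' : term gen l m) :
    teq R g g' -> teq R f f' -> teq R (g ∘ f) (g' ∘ f')
| teq_tens m n p q (f f' : term gen m n) (g g' : term gen p q) :
    teq R f f' -> teq R g g' -> teq R (f ⊗ g) (f' ⊗ g')
| teq_comp_idl m n (f : term gen m n) : teq R (tid n ∘ f) f
| teq_comp_idr m n (f : term gen m n) : teq R (f ∘ tid m) f
| teq_comp_assoc k l m n (h : term gen m n) (g : term gen l m)
    (f : term gen k l) : teq R (h ∘ (g ∘ f)) ((h ∘ g) ∘ f)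
| teq_tens_id m n : teq R (tid m ⊗ tid n) (tid (m + n))
| teq_tens_comp m m' m'' n n' n'' (f' : term gen m' m'') (f : term gen m m')
    (g' : term gen n' n'') (g : term gen n n') :
    teq R ((f' ∘ f) ⊗ (g' ∘ g)) ((f' ⊗ g') ∘ (f ⊗ g))
| teq_tens_A m m' n n' p p' (f : term gen m m') (g : term gen n n')
    (h : term gen p p') :
    teq R (tcast gen (addnA m' n' p') ∘ (f ⊗ (g ⊗ h)))
          (((f ⊗ g) ⊗ h) ∘ tcast gen (addnA m n p))
| teq_tens_1l m n (f : term gen m n) :
    teq R (tcast gen (add0n n) ∘ (tid 0 ⊗ f)) (f ∘ tcast gen (add0n m))
| teq_tens_1r m n (f : term gen m n) :
    teq R (tcast gen (addn0 n) ∘ (f ⊗ tid 0)) (f ∘ tcast gen (addn0 m))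
| teq_br_brV m n : teq R (tbr m n ∘ tbrV m n) (tid (n + m))
| teq_brV_br m n : teq R (tbrV m n ∘ tbr m n) (tid (m + n))
| teq_br_nat m m' n n' (f : term gen m m') (g : term gen n n') :
    teq R (tbr m' n' ∘ (f ⊗ g)) ((g ⊗ f) ∘ tbr m n)
| teq_br_hexl m n p :
    teq R (tbr (m + n) p ∘ tcast gen (addnA m n p))
          (tcast gen (esym (addnA p m n)) ∘ (tbr m p ⊗ tid n)
             ∘ tcast gen (addnA m p n) ∘ (tid m ⊗ tbr n p))
| teq_br_hexr m n p :
    teq R (tbr m (n + p))
          (tcast gen (addnA n p m) ∘ (tid n ⊗ tbr m p)
             ∘ tcast gen (esym (addnA n m p)) ∘ (tbr m n ⊗ tid p)
             ∘ tcast gen (addnA m n p)).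

End Congruence.

Section FreeCategory.
Variables (gen : nat -> nat -> Type) (R : trel gen).

Definition free_category : category.
Proof.
refine (@Category nat (term gen) (@teq gen R) (@tid gen) (@tcomp gen)
  _ _ _ _ _ _ _).
- exact: teq_refl.
- exact: teq_sym.
- exact: teq_trans.
- exact: teq_comp.
- exact: teq_comp_idl.
- exact: teq_comp_idr.
- exact: teq_comp_assoc.
Defined.

(* The braided strict monoidal category presented by [gen] and [R]. *)
Definition free_bsmcat : bsmcat.
Proof.
refine (@BSMCat free_category 0 addn addnA add0n addn0 (@ttens gen)
  (@tbr gen) (@tbrV gen) _ _ _ _ _ _ _ _ _ _ _).
- exact: teq_tens.
- exact: teq_tens_id.
- exact: teq_tens_comp.
- exact: teq_tens_A.
- exact: teq_tens_1l.
- exact: teq_tens_1r.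
- exact: teq_br_brV.
- exact: teq_brV_br.
- exact: teq_br_nat.
- exact: teq_br_hexl.
- exact: teq_br_hexr.
Defined.

End FreeCategory.

Inductive common_gen : nat -> nat -> Type :=
| Mu : common_gen 2 1
| Eta : common_gen 0 1
| Delta : common_gen 1 2
| Eps : common_gen 1 0
| Anti : common_gen 1 1
| AntiV : common_gen 1 1
| Vp : common_gen 0 1
| Vm : common_gen 0 1
| W : common_gen 0 2.

Inductive habiro_gen : nat -> nat -> Type :=
| HCommon m n : common_gen m n -> habiro_gen m n
| Wbar : habiro_gen 2 0.

Inductive kerler_gen : nat -> nat -> Type :=
| KCommon m n : common_gen m n -> kerler_gen m n
| Lam : kerler_gen 1 0
| BigLam : kerler_gen 0 1.

Section CommonRelations.
Local Open Scope term_scope.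
Variables (gen : nat -> nat -> Type)
          (i : forall m n, common_gen m n -> gen m n).

Local Notation mu := (@tgen gen 2 1 (i Mu)).
Local Notation eta := (@tgen gen 0 1 (i Eta)).
Local Notation delta := (@tgen gen 1 2 (i Delta)).
Local Notation eps := (@tgen gen 1 0 (i Eps)).
Local Notation anti := (@tgen gen 1 1 (i Anti)).
Local Notation antiV := (@tgen gen 1 1 (i AntiV)).
Local Notation vp := (@tgen gen 0 1 (i Vp)).
Local Notation vm := (@tgen gen 0 1 (i Vm)).
Local Notation w := (@tgen gen 0 2 (i W)).
Local Notation id1 := (@tid gen 1).
Local Notation id2 := (@tid gen 2).
Local Notation c := (@tbr gen 1 1).
Local Notation cV := (@tbrV gen 1 1).

(* The left adjoint action. *)
Definition adj : term gen 2 1 := mu ∘ (mu ⊗ anti) ∘ (id1 ⊗ c) ∘ (delta ⊗ id1).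

(* Types such as [term gen (2 + 1) (1 + 1)] and [term gen 3 2] are convertible,
   so strict associativity and unitality need no casts here. *)
Inductive common_rel : trel gen :=
| mu_assoc : @common_rel 3 1 (mu ∘ (mu ⊗ id1)) (mu ∘ (id1 ⊗ mu))
| mu_unitl : @common_rel 1 1 (mu ∘ (eta ⊗ id1)) id1
| mu_unitr : @common_rel 1 1 (mu ∘ (id1 ⊗ eta)) id1
| delta_coassoc :
    @common_rel 1 3 ((delta ⊗ id1) ∘ delta) ((id1 ⊗ delta) ∘ delta)
| delta_counitl : @common_rel 1 1 ((eps ⊗ id1) ∘ delta) id1
| delta_counitr : @common_rel 1 1 ((id1 ⊗ eps) ∘ delta) id1
| delta_mu :
    @common_rel 2 2 ((mu ⊗ mu) ∘ (id1 ⊗ c ⊗ id1) ∘ (delta ⊗ delta))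
                    (delta ∘ mu)
| eps_mu : @common_rel 2 0 (eps ∘ mu) (eps ⊗ eps)
| delta_eta : @common_rel 0 2 (delta ∘ eta) (eta ⊗ eta)
| eps_eta : @common_rel 0 0 (eps ∘ eta) (tid 0)
| antil : @common_rel 1 1 (mu ∘ (anti ⊗ id1) ∘ delta) (eta ∘ eps)
| antir : @common_rel 1 1 (mu ∘ (id1 ⊗ anti) ∘ delta) (eta ∘ eps)
| anti_antiV : @common_rel 1 1 (anti ∘ antiV) id1
| antiV_anti : @common_rel 1 1 (antiV ∘ anti) id1
| adj_cocomm :
    @common_rel 2 2 ((adj ⊗ id1) ∘ (id1 ⊗ c) ∘ (delta ⊗ id1))
                    (cV ∘ (id1 ⊗ adj) ∘ (delta ⊗ id1))
| vp_central : @common_rel 1 1 (mu ∘ (vp ⊗ id1)) (mu ∘ (id1 ⊗ vp))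
| vp_vm : @common_rel 0 1 (mu ∘ (vp ⊗ vm)) eta
| eps_vp : @common_rel 0 0 (eps ∘ vp) (tid 0)
| anti_vp : @common_rel 0 1 (anti ∘ vp) vp
| w_def : @common_rel 0 2 w ((mu ⊗ mu) ∘ (vm ⊗ id2 ⊗ vm) ∘ delta ∘ vp)
| w_delta :
    @common_rel 0 3 ((id1 ⊗ delta) ∘ w) ((mu ⊗ id2) ∘ (id1 ⊗ w ⊗ id1) ∘ w).

End CommonRelations.

Section HabiroRelations.
Local Open Scope term_scope.
Local Notation mu := (@tgen habiro_gen 2 1 (HCommon Mu)).
Local Notation vp := (@tgen habiro_gen 0 1 (HCommon Vp)).
Local Notation w := (@tgen habiro_gen 0 2 (HCommon W)).
Local Notation wbar := (@tgen habiro_gen 2 0 Wbar).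
Local Notation id1 := (@tid habiro_gen 1).

Inductive habiro_rel : trel habiro_gen :=
| habiro_common m n (f g : term habiro_gen m n) :
    common_rel HCommon f g -> habiro_rel f g
| wbar_w : @habiro_rel 1 1 ((id1 ⊗ wbar) ∘ (w ⊗ id1)) id1
| wbar_vp : @habiro_rel 0 0 (wbar ∘ (mu ⊗ vp) ∘ (vp ⊗ vp)) (tid 0).

End HabiroRelations.

Section KerlerRelations.
Local Open Scope term_scope.
Local Notation mu := (@tgen kerler_gen 2 1 (KCommon Mu)).
Local Notation eta := (@tgen kerler_gen 0 1 (KCommon Eta)).
Local Notation delta := (@tgen kerler_gen 1 2 (KCommon Delta)).
Local Notation eps := (@tgen kerler_gen 1 0 (KCommon Eps)).
Local Notation anti := (@tgen kerler_gen 1 1 (KCommon Anti)).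
Local Notation vp := (@tgen kerler_gen 0 1 (KCommon Vp)).
Local Notation w := (@tgen kerler_gen 0 2 (KCommon W)).
Local Notation lambda := (@tgen kerler_gen 1 0 Lam).
Local Notation Lambda := (@tgen kerler_gen 0 1 BigLam).
Local Notation id1 := (@tid kerler_gen 1).

Inductive kerler_rel : trel kerler_gen :=
| kerler_common m n (f g : term kerler_gen m n) :
    common_rel KCommon f g -> kerler_rel f g
| lam_integral : @kerler_rel 1 1 ((id1 ⊗ lambda) ∘ delta) (eta ∘ lambda)
| Lam_integral : @kerler_rel 1 1 (mu ∘ (Lambda ⊗ id1)) (Lambda ∘ eps)
| lam_Lam : @kerler_rel 0 0 (lambda ∘ Lambda) (tid 0)
| anti_Lam : @kerler_rel 0 1 (anti ∘ Lambda) Lambda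
| lam_anti : @kerler_rel 1 0 (lambda ∘ anti) lambda
| lam_w : @kerler_rel 0 1 ((lambda ⊗ id1) ∘ w) Lambda
| lam_vp : @kerler_rel 0 0 (lambda ∘ vp) (tid 0).

End KerlerRelations.

Definition Alg3H : bsmcat := free_bsmcat habiro_rel.
Definition Alg3K : bsmcat := free_bsmcat kerler_rel.

Definition free_hopf_structure gen (R : trel gen)
    (i : forall m n, common_gen m n -> gen m n) :
    hopf_structure (free_bsmcat R) :=
  @HopfStructure (free_bsmcat R) 1
    (tgen (i _ _ Mu)) (tgen (i _ _ Eta)) (tgen (i _ _ Delta))
    (tgen (i _ _ Eps)) (tgen (i _ _ Anti)) (tgen (i _ _ AntiV))
    (tgen (i _ _ Vp)) (tgen (i _ _ Vm)) (tgen (i _ _ W)).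

Definition habiro_hopf : hopf_structure Alg3H :=
  free_hopf_structure habiro_rel HCommon.
Definition kerler_hopf : hopf_structure Alg3K :=
  free_hopf_structure kerler_rel KCommon.

(* Main.v *)
From mathcomp Require Import all_boot zify.
Require Import Defs.

Set Implicit Arguments.
Unset Strict Implicit.
Unset Printing Implicit Defensive.

(** Both categories are free, so a functor out of one of them is a substitution
    for its generators that respects the defining relations, and two such
    functors are mutually inverse as soon as they are so on generators.  The
    common generators are kept.  What has to be found is an expression of the
    Habiro pairing w̄ through the Kerler integrals λ and Λ, and conversely.
    Below, w = w' ⊗ w'' and Δx = x_1 ⊗ x_2, crossings are not shown, and v_- is
    written v.

    From Kerler to Habiro, put w̄(x, y) = λ(u' S y) λ(u'' x), where u is a copy
    of w placed to the left of x ([kwbar]).  As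
    (Δ ⊗ id) w = w' ⊗ u' ⊗ u'' w'' ([w_delta_l]) and w' λ(w'') = Λ, the zigzag
    w' w̄(w'', y) = y becomes the Frobenius identity Λ_1 λ(Λ_2 S y) = y
    ([frobenius]), which follows from the integral properties of λ and Λ.

    From Habiro to Kerler, put λ(x) = w̄(v, v x) and Λ = λ(w') w'' ([hlam],
    [hLam]).  Since S v_+ = v_+, the copairing satisfies (S ⊗ S) c w = w
    ([w_sym]), which turns the given zigzag into the opposite one
    ([wbar_zigzag_r]).  So w̄ and w form a duality; w̄ is then a Hopf pairing, and
    λ = w̄(Λ, -).  Through the duality the integral property of Λ is equivalent
    to the one of λ.  The latter ([hlam_integral]) is the heart of the matter:
    w is Δv_+ up to factors v_±, so x_1 λ(x_2) can be rewritten with the help of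
    w and the pairing into S^{-1}(S(z_1) w̄(v, z_2) z_3), where z = v x; and
    S(z_1) w̄(v, z_2) z_3 = η w̄(v, z) is the dual form of the centrality
    y_1 v S(y_2) = ε(y) v.  The normalizations follow from
    λ(v w') w'' = λ(v) v_+ ([fourier_vm]), which pairs to
    λ(v) w̄(v_+, x) = λ(v x); at x = v_+ v_+ the relation
    w̄(v_+ v_+, v_+) = 1 yields λ(v) = 1, and λ(Λ) = λ(v).

    The two constructions are mutually inverse: an inverse of w is unique, and
    λ(v_+ w') w'' = v ([fourier_vp]) gives back λ(x) = w̄(v, v x).

    All these identities are computed with diagrams.  Morphisms are flattened to
    lists of elementary pieces, compared up to planar isotopy, and a chain of
    rewriting steps is located by a search whose outcome is certified
    ([derivesP]).  A proof thus lists intermediate diagrams together with the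
    identities that lead from each one to the next. *)

(** * Equality of formal morphisms across equal objects *)

Local Open Scope term_scope.

Section HeterogeneousEquality.
Variables (gen : nat -> nat -> Type) (R : trel gen).
Local Notation term := (term gen).

(** Strictness makes (f ⊗ g) ⊗ h and f ⊗ (g ⊗ h) equal only up to casts between
    m + (n + p) and (m + n) + p.  Relating terms whose types differ by provable
    equalities of objects lets all these casts disappear. *)
Inductive hteq m n (f : term m n) : forall m' n', term m' n' -> Prop :=
| Hteq (g : term m n) : teq R f g -> hteq f g.

Local Infix "≡" := hteq (at level 70).

Lemma hteq_dim m n (f : term m n) m' n' (g : term m' n') :
  f ≡ g -> m = m' /\ n = n'.
Proof. by case. Qed.

(** Sound because equality proofs between numbers are unique. *)
Lemma hteqP m n (f g : term m n) : f ≡ g -> teq R f g.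
Proof.
suff H m' n' (g' : term m' n') (em : m' = m) (en : n' = n) : f ≡ g' ->
    teq R f (match em in _ = a return term a n with erefl =>
             match en in _ = b return term m' b with erefl => g' end end).
  by move/(H _ _ g erefl erefl).
move=> E; case: _ _ g' / E em en => g' fg em en.
by rewrite (eq_irrelevance em erefl) (eq_irrelevance en erefl).
Qed.

Lemma hrefl m n (f : term m n) : f ≡ f.
Proof. exact/Hteq/teq_refl. Qed.

Lemma hsym m n (f : term m n) m' n' (g : term m' n') : f ≡ g -> g ≡ f.
Proof. by case=> {}g fg; apply/Hteq/teq_sym. Qed.

Lemma htrans m n (f : term m n) m' n' (g : term m' n') p q (h : term p q) :
  f ≡ g -> g ≡ h -> f ≡ h.
Proof.
case=> {}g fg E; case: _ _ h / E => h gh.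
exact/Hteq/(teq_trans fg gh).
Qed.

Lemma hcomp l m n (g : term m n) (f : term l m)
    l' m' n' (g' : term m' n') (f' : term l' m') :
  g ≡ g' -> f ≡ f' -> g ∘ f ≡ g' ∘ f'.
Proof.
move=> gg ff; have [em _] := hteq_dim gg; move: em gg ff => em.
case: _ / em g' f' => g' f' gg; have [_ en] := hteq_dim gg.
move: gg; case: _ / en g' => g' /hteqP gg ff; have [el _] := hteq_dim ff.
move: ff; case: _ / el f' => f' /hteqP ff.
exact/Hteq/teq_comp.
Qed.

Lemma htens m n p q (f : term m n) (g : term p q)
    m' n' p' q' (f' : term m' n') (g' : term p' q') :
  f ≡ f' -> g ≡ g' -> f ⊗ g ≡ f' ⊗ g'.
Proof.
by move=> [{}f' ff] [{}g' gg]; apply/Hteq/teq_tens.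
Qed.

Lemma htcast m n (e : m = n) : tcast gen e ≡ @tid gen m.
Proof. by case: _ / e; apply: hrefl. Qed.

Lemma hidl m n (f : term m n) k (h : term n k) : h ≡ @tid gen n -> h ∘ f ≡ f.
Proof.
move=> H; have [_ e] := hteq_dim H; move: h H.
rewrite e => h /hteqP H.
exact: Hteq (teq_trans (teq_comp H (teq_refl _ _)) (teq_comp_idl _ _)).
Qed.

Lemma hidr m n (f : term m n) k (h : term k m) : h ≡ @tid gen m -> f ∘ h ≡ f.
Proof.
move=> H; have [e _] := hteq_dim H; move: h H.
rewrite e => h /hteqP H.
exact: Hteq (teq_trans (teq_comp (teq_refl _ _) H) (teq_comp_idr _ _)).
Qed.

Lemma hassoc k l m n (h : term m n) (g : term l m) (f : term k l) :
  h ∘ (g ∘ f) ≡ (h ∘ g) ∘ f.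
Proof. exact/Hteq/teq_comp_assoc. Qed.

Lemma htensA m n p m' n' p' (f : term m m') (g : term n n') (h : term p p') :
  f ⊗ (g ⊗ h) ≡ (f ⊗ g) ⊗ h.
Proof.
apply: htrans (hsym (hidl _ (htrans (htcast (addnA m' n' p')) _))) _.
  by rewrite addnA; apply: hrefl.
apply: htrans (Hteq (teq_tens_A _ f g h)) (hidr _ _).
apply: (htrans (htcast _)); rewrite addnA; exact: hrefl.
Qed.

Lemma htens0l m n (f : term m n) : @tid gen 0 ⊗ f ≡ f.
Proof.
have H := Hteq (teq_tens_1l R f).
apply: htrans (hsym (hidl _ (htcast (add0n n)))) (htrans H _).
exact: hidr (htcast _).
Qed.

Lemma htens0r m n (f : term m n) : f ⊗ @tid gen 0 ≡ f.
Proof.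
have H := Hteq (teq_tens_1r R f).
apply: htrans (hsym (hidl _ (htcast (addn0 n)))) (htrans H _).
by apply: hidr; apply: (htrans (htcast _)); rewrite addn0; apply: hrefl.
Qed.

Lemma htensid m n : @tid gen m ⊗ @tid gen n ≡ @tid gen (m + n).
Proof. exact/Hteq/teq_tens_id. Qed.

Lemma htensC m m' m'' n n' n'' (f' : term m' m'') (f : term m m')
    (g' : term n' n'') (g : term n n') :
  (f' ⊗ g') ∘ (f ⊗ g) ≡ (f' ∘ f) ⊗ (g' ∘ g).
Proof. exact/hsym/Hteq/teq_tens_comp. Qed.

Lemma hcast m n (f : term m n) m' n' :
  m = m' -> n = n' -> exists f' : term m' n', f ≡ f'.
Proof. by move=> <- <-; exists f; apply: hrefl. Qed.

Lemma hid m n : m = n -> @tid gen m ≡ @tid gen n.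
Proof. by move->; apply: hrefl. Qed.

Lemma htens_lr m n p q (f : term m n) (g : term p q) :
  (@tid gen n ⊗ g) ∘ (f ⊗ @tid gen p) ≡ f ⊗ g.
Proof.
apply: htrans (htensC _ _ _ _) _; apply: htens; [apply: hidl | apply: hidr];
exact: hrefl.
Qed.

Lemma htens_rl m n p q (f : term m n) (g : term p q) :
  (f ⊗ @tid gen q) ∘ (@tid gen m ⊗ g) ≡ f ⊗ g.
Proof.
apply: htrans (htensC _ _ _ _) _; apply: htens; [apply: hidr | apply: hidl];
exact: hrefl.
Qed.

Lemma htensl k l m n (g : term m n) (f : term l m) :
  @tid gen k ⊗ (g ∘ f) ≡ (@tid gen k ⊗ g) ∘ (@tid gen k ⊗ f).
Proof.
apply/hsym/(htrans (htensC _ _ _ _)); apply: htens (hrefl _).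
exact: hidl (hrefl _).
Qed.

Lemma htensr k l m n (g : term m n) (f : term l m) :
  (g ∘ f) ⊗ @tid gen k ≡ (g ⊗ @tid gen k) ∘ (f ⊗ @tid gen k).
Proof.
apply/hsym/(htrans (htensC _ _ _ _)); apply: htens (hrefl _) _.
exact: hidl (hrefl _).
Qed.

End HeterogeneousEquality.

(** * Diagrams as words of layers *)

(** Crossings of single strands generate all braidings, by the hexagons. *)
Inductive atom (gen : nat -> nat -> Type) : Type :=
| Pos | Neg | Gen m n of gen m n.
Arguments Pos {gen}.
Arguments Neg {gen}.
Arguments Gen {gen m n} _.

Section Words.
Variables (gen : nat -> nat -> Type) (R : trel gen).
Local Notation term := (term gen).
Local Notation tid := (@tid gen).
Local Notation "f ≡ g" := (hteq R f g) (at level 70).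

Definition src (a : atom gen) := if a is @Gen _ m _ _ then m else 2.
Definition tgt (a : atom gen) := if a is @Gen _ _ n _ then n else 2.

Definition aterm (a : atom gen) : term (src a) (tgt a) :=
  match a with Pos => tbr 1 1 | Neg => tbrV 1 1 | Gen _ _ g => tgen g end.

Definition word := seq (nat * atom gen).

Definition layer k a r : term (k + (src a + r)) (k + (tgt a + r)) :=
  tid k ⊗ (aterm a ⊗ tid r).

(** A word lists layers in their order of application; (k, a) stands for [a] with
    k strands on its left.  A word does not know its number of input strands, so
    it denotes one morphism for each width at which it makes sense; [den w f]
    says that [f] is such a morphism. *)
Fixpoint den (w : word) m n (f : term m n) : Prop :=
  if w is (k, a) :: w' then
    exists r (g : term (k + (tgt a + r)) n), den w' g /\ f ≡ g ∘ layer k a r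
  else f ≡ tid m.

Definition shift k (w : word) : word := [seq (k + x.1, x.2) | x <- w].

Lemma den_heq w m n (f : term m n) m' n' (g : term m' n') :
  f ≡ g -> den w f -> den w g.
Proof.
case=> {}g fg; case: w => [|[k a] w] /=.
  exact: htrans (hsym (Hteq fg)).
move=> [r [h [wh fh]]]; exists r, h; split=> //.
exact: htrans (hsym (Hteq fg)) fh.
Qed.

Lemma den_fun w m n (f : term m n) n' (g : term m n') :
  den w f -> den w g -> f ≡ g.
Proof.
elim: w m n f n' g => [|[k a] w IH] m n f n' g /=.
  by move=> fi gi; apply: htrans fi (hsym gi).
move=> [r [f1 [wf ff]]] [r' [g1 [wg gg]]].
have er : r = r' by have := hteq_dim ff; have := hteq_dim gg; lia.
case: _ / er g1 wg gg => g1 wg gg.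
apply: htrans ff (htrans _ (hsym gg)).
exact: hcomp (IH _ _ _ _ _ wf wg) (hrefl _ _).
Qed.

Lemma den_cat w1 w2 m n p (f : term m n) (g : term n p) :
  den w1 f -> den w2 g -> den (w1 ++ w2) (g ∘ f).
Proof.
elim: w1 m n f g => [|[k a] w IH] m n f g /=.
  move=> fi; apply: den_heq; apply/hsym/hidr.
  by have [_ e] := hteq_dim fi; rewrite e in f g fi *.
move=> [r [f1 [wf ff]]] wg; exists r, (g ∘ f1); split; first exact: IH.
exact: htrans (hcomp (hrefl _ _) ff) (hassoc _ _ _ _).
Qed.

Lemma den_catE w1 w2 m p (h : term m p) : den (w1 ++ w2) h ->
  exists n (f : term m n) (g : term n p), [/\ den w1 f, den w2 g & h ≡ g ∘ f].
Proof.
elim: w1 m h => [|[k a] w IH] m h /=.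
  move=> wh; exists m, (tid m), h; split=> //; first exact: hrefl.
  exact/hsym/hidr/hrefl.
move=> [r [h1 [/IH[n [f [g [wf wg hgf]]]] hh]]].
have [em _] := hteq_dim hh; move: h hh; rewrite em => h hh.
exists n, (f ∘ layer k a r), g; split=> //.
  by exists r, f; split=> //; apply: hrefl.
exact: htrans hh (htrans (hcomp hgf (hrefl _ _)) (hsym (hassoc _ _ _ _))).
Qed.

Lemma layer_tens k l a s r :
  tid k ⊗ (layer l a s ⊗ tid r) ≡ layer (k + l) a (s + r).
Proof.
rewrite /layer.
have H1 : (tid l ⊗ (aterm a ⊗ tid s)) ⊗ tid r ≡
    tid l ⊗ (aterm a ⊗ tid (s + r)).
  apply: htrans (hsym (htensA _ _ _ _)) (htens (hrefl _ _) _).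
  exact: htrans (hsym (htensA _ _ _ _)) (htens (hrefl _ _) (htensid _ _ _)).
apply: htrans (htens (hrefl _ _) H1) (htrans (htensA _ _ _ _) _).
exact: htens (htensid _ _ _) (hrefl _ _).
Qed.

Lemma den_shift w m n (f : term m n) k r :
  den w f -> den (shift k w) (tid k ⊗ (f ⊗ tid r)).
Proof.
elim: w m n f => [|[l a] w IH] m n f /=.
  move=> fi; apply: htrans (htens (hrefl _ _) (htens fi (hrefl _ _))) _.
  exact: htrans (htens (hrefl _ _) (htensid _ _ _)) (htensid _ _ _).
move=> [s [g [/IH wg fg]]].
have [| g' gg] := @hcast gen R _ _ (tid k ⊗ (g ⊗ tid r))
  (k + l + (tgt a + (s + r))) (k + (n + r)) _ erefl; first by lia.
exists (s + r), g'; split; first exact: den_heq gg wg.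
apply: htrans (htens (hrefl _ _) (htens fg (hrefl _ _))) _.
apply: htrans (htens (hrefl _ _) (htensr _ _ _ _)) _.
apply: htrans (htensl _ _ _ _) (hcomp gg (layer_tens _ _ _ _ _)).
Qed.

Lemma layer_split l s d a r :
  layer (l + (s + d)) a r ≡ tid l ⊗ (tid s ⊗ layer d a r).
Proof.
rewrite /layer; apply/hsym.
apply: htrans (htens (hrefl _ _) (htensA _ _ _ _)) _.
apply: htrans (htensA _ _ _ _) (htens _ (hrefl _ _)).
exact: htrans (htens (hrefl _ _) (htensid _ _ _)) (htensid _ _ _).
Qed.

Lemma layer_swap l b d a r :
  (layer l b _) ∘ (tid l ⊗ (tid (src b) ⊗ layer d a r)) ≡
  (tid l ⊗ (tid (tgt b) ⊗ layer d a r)) ∘ (layer l b _).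
Proof.
apply: htrans (hsym (htensl _ _ _ _)) (htrans _ (htensl _ _ _ _)).
apply: htens (hrefl _ _) _.
exact: htrans (htens_rl _ _ _) (hsym (htens_lr _ _ _)).
Qed.

(** The interchange law: two consecutive layers that touch no common strand may
    be permuted, at the price of shifting the one on the right. *)
Lemma den_swap l b d a w m n (f : term m n) :
  den ((l + (src b + d), a) :: (l, b) :: w) f <->
  den ((l, b) :: (l + (tgt b + d), a) :: w) f.
Proof.
split=> /= -[r [f1 [[s [g [wg fg]]] ff]]].
- have e : s = d + (tgt a + r) by have := hteq_dim fg; lia.
  case: _ / (esym e) g wg fg => g wg fg {e}.
  have [| g' gg] := @hcast gen R _ _ g (l + (tgt b + d) + (tgt a + r)) n _ erefl.
    by lia.
  have [| g2 gg2] := @hcast gen R _ _ (g' ∘ layer (l + (tgt b + d)) a r)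
    (l + (tgt b + (d + (src a + r)))) n _ erefl; first by lia.
  exists (d + (src a + r)), g2; split.
    exists r, g'; split; first exact: den_heq gg wg.
    exact/hsym.
  apply: htrans ff _; apply: htrans (hcomp fg (layer_split _ _ _ _ _)) _.
  apply: htrans (hsym (hassoc _ _ _ _)) _.
  apply: htrans (hcomp (hrefl _ _) (layer_swap _ _ _ _ _)) _.
  apply: htrans (hassoc _ _ _ _) (hcomp _ (hrefl _ _)).
  apply: htrans gg2; apply: hcomp gg _.
  exact/hsym/layer_split.
- have e : r = d + (src a + s) by have := hteq_dim fg; lia.
  case: _ / (esym e) f1 fg ff => f1 fg ff {e}.
  have [| g' gg] := @hcast gen R _ _ g (l + (tgt b + (d + (tgt a + s)))) n _ erefl.
    by lia.
  have [| g2 gg2] := @hcast gen R _ _ (g' ∘ layer l b (d + (tgt a + s)))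
    (l + (src b + d) + (tgt a + s)) n _ erefl; first by lia.
  exists s, g2; split.
    exists (d + (tgt a + s)), g'; split; first exact: den_heq gg wg.
    exact/hsym.
  apply: htrans ff _.
  apply: htrans (hcomp (htrans fg (hcomp gg (layer_split _ _ _ _ _))) (hrefl _ _)) _.
  apply: htrans (hsym (hassoc _ _ _ _)) _.
  apply: htrans (hcomp (hrefl _ _) (hsym (layer_swap _ _ _ _ _))) _.
  apply: htrans (hassoc _ _ _ _) (hcomp gg2 _).
  exact/hsym/layer_split.
Qed.

(** Planar isotopy is decided by sorting: a layer lying entirely to the left of
    the layer below it is moved below.  A disconnected closed piece can circle
    around other pieces, so words with such pieces may escape the comparison;
    the number of passes is bounded for the same reason. *)
Fixpoint pass (x : nat * atom gen) (w : word) : word :=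
  if w is y :: w' then
    if y.1 + src y.2 <= x.1 then
      y :: pass (x.1 - src y.2 + tgt y.2, x.2) w'
    else x :: pass y w'
  else [:: x].

Definition norm (w : word) : word :=
  iter (size w) (fun w => if w is x :: w' then pass x w' else [::]) w.

Lemma den_cons w w' x : (forall m n (f : term m n), den w f <-> den w' f) ->
  forall m n (f : term m n), den (x :: w) f <-> den (x :: w') f.
Proof.
case: x => k a E m n f /=; split=> -[r [g [wg fg]]]; exists r, g;
by split=> //; apply/E.
Qed.

Lemma den_pass x w m n (f : term m n) : den (x :: w) f <-> den (pass x w) f.
Proof.
elim: w x m n f => [|y w IH] [k a] m n f; first by [].
rewrite [pass _ _]/=; case: ifP => [le|_]; last exact: den_cons.
case: y le => l b /= le; rewrite -/den.
have [d ->] : exists d, k = l + (src b + d) by exists (k - (l + src b)); lia.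
have -> : l + (src b + d) - src b + tgt b = l + (tgt b + d) by lia.
apply: iff_trans (den_swap l b d a w f) _.
exact: den_cons.
Qed.

Lemma den_norm w m n (f : term m n) : den w f <-> den (norm w) f.
Proof.
rewrite /norm; elim: (size w) => [|k IH] //=.
apply: iff_trans IH _; case: (iter k _ w) => [|x w'] //; exact: den_pass.
Qed.

Definition width m (w : word) :=
  foldl (fun d (x : nat * atom gen) => d - src x.2 + tgt x.2) m w.

Lemma den_width w m n (f : term m n) : den w f -> n = width m w.
Proof.
elim: w m f => [|[k a] w IH] m f /=; first by case/hteq_dim.
move=> [r [g [/IH wg /hteq_dim[-> _]]]].
by rewrite wg /width /=; congr foldl; lia.
Qed.

(** The bound on the width matters: the word of [fl] may be empty, or may fail to
    reach its rightmost input strands. *)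
Lemma den_replace p q k l r m n (f : term m n) a b (fl fr : term a b) :
    teq R fl fr -> den l fl -> den r fr -> k + a <= width m p ->
  den (p ++ shift k l ++ q) f -> den (p ++ shift k r ++ q) f.
Proof.
move=> E wl wr le /den_catE[c [f1 [f2 [w1 /den_catE[d [f3 [f4 [w3 w4 e2]]]] e1]]]].
have ec := den_width w1.
have {}ec : c = k + (a + (c - (k + a))) by lia.
move: (c - (k + a)) ec => s ec.
case: _ / (esym ec) f1 f2 w1 e1 f3 w3 e2 => f1 f2 w1 e1 f3 w3 e2 {ec}.
have H3 := den_fun w3 (den_shift k s wl).
apply: den_heq (hsym e1) _; apply: den_cat w1 _; apply: den_heq (hsym e2) _.
apply: den_cat w4; apply: den_heq (den_shift k s wr); apply/hsym.
apply: htrans H3 _; apply: htens (hrefl _ _) (htens (Hteq E) (hrefl _ _)).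
Qed.

(** [brw1 n] carries the first strand across the n following ones; [brw m n]
    carries m strands across n, the innermost one first.  [brwV1] and [brwV]
    are their inverses. *)
Fixpoint brw1 n : word :=
  if n is n'.+1 then (0, Pos) :: shift 1 (brw1 n') else [::].
Fixpoint brw m n : word :=
  if m is m'.+1 then shift 1 (brw m' n) ++ brw1 n else [::].
Fixpoint brwV1 n : word :=
  if n is n'.+1 then shift 1 (brwV1 n') ++ [:: (0, Neg)] else [::].
Fixpoint brwV m n : word :=
  if m is m'.+1 then brwV1 n ++ shift 1 (brwV m' n) else [::].

(** By the hexagons, the braiding with the unit object is idempotent; being
    invertible, it is the identity. *)
Lemma idem_inv_id m (b c : term m m) : b ≡ b ∘ b -> c ∘ b ≡ tid m -> b ≡ tid m.
Proof.
move=> bb cb; apply: htrans (hsym (hidl _ cb)) _.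
exact: htrans (hsym (hassoc _ _ _ _)) (htrans (hcomp (hrefl _ _) (hsym bb)) cb).
Qed.

Lemma hbr_hexl m n p (x : term (m + (n + p)) (m + (p + n)))
    (y : term (m + (p + n)) (p + m + n)):
  x ≡ tid m ⊗ @tbr gen n p -> y ≡ @tbr gen m p ⊗ tid n ->
  tbr (m + n) p ≡ y ∘ x.
Proof.
move=> xE yE; have H := Hteq (teq_br_hexl R m n p).
have ca (a b : nat) (e : a = b) : tcast gen e ≡ tid b.
  by case: _ / e; apply: hrefl.
apply: htrans (htrans H _).
  apply/hsym/hidr; exact: ca.
apply: hcomp (hsym xE); apply: htrans (hsym yE).
apply: htrans (hidr _ (ca _ _ _)) _.
exact: hidl (htcast _ _).
Qed.

Lemma hbr_hexr m n p (x : term (m + (n + p)) (n + (m + p)))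
    (y : term (n + (m + p)) (n + (p + m))):
  x ≡ @tbr gen m n ⊗ tid p -> y ≡ tid n ⊗ @tbr gen m p ->
  tbr m (n + p) ≡ y ∘ x.
Proof.
move=> xE yE; have H := Hteq (teq_br_hexr R m n p).
have ca (a b : nat) (e : a = b) : tcast gen e ≡ tid b.
  by case: _ / e; apply: hrefl.
apply: htrans H _; apply: htrans (hidr _ (ca _ _ _)) _.
apply: hcomp _ (hsym xE) => //.
apply: htrans (hsym yE); apply: htrans (hidr _ (ca _ _ _)) _.
exact: hidl (htcast _ _).
Qed.

Lemma hbr0 p : tbr 0 p ≡ tid p.
Proof.
have [b bE] := hcast R (@tbr gen 0 p) (add0n p) (addn0 p).
have [c cE] := hcast R (@tbrV gen 0 p) (addn0 p) (add0n p).
have [y yE] := hcast R b (esym (addn0 p)) (esym (etrans (addn0 _) (addn0 p))).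
apply: (htrans bE); apply: (@idem_inv_id _ _ c).
  apply: (htrans (hsym bE)).
  have H := @hbr_hexl 0 0 p (tbr 0 p) y (hsym (htens0l _ _)).
  apply: htrans (H _) (hcomp (hsym yE) bE).
  exact: htrans (hsym yE) (htrans (hsym bE) (hsym (htens0r _ _))).
apply: htrans (hcomp (hsym cE) (hsym bE)) _.
exact: Hteq (teq_brV_br R 0 p).
Qed.

Lemma hbr0r p : tbr p 0 ≡ tid p.
Proof.
have [b bE] := hcast R (@tbr gen p 0) (addn0 p) (add0n p).
have [c cE] := hcast R (@tbrV gen p 0) (add0n p) (addn0 p).
have [x xE] := hcast R b (esym (addn0 p)) (esym (addn0 p)).
apply: (htrans bE); apply: (@idem_inv_id _ _ c).
  apply: (htrans (hsym bE)).
  have H := @hbr_hexr p 0 0 x (tbr p 0) _ (hsym (htens0l _ _)).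
  apply: htrans (H _) (hcomp bE (hsym xE)).
  exact: htrans (hsym xE) (htrans (hsym bE) (hsym (htens0r _ _))).
apply: htrans (hcomp (hsym cE) (hsym bE)) _.
apply: htrans (Hteq (teq_brV_br R p 0)) (hid _ _); exact: addn0.
Qed.

Lemma den_shift0 w m n (f : term m n) k :
  den w f -> den (shift k w) (tid k ⊗ f).
Proof.
move/(den_shift k 0); apply: den_heq; exact: htens (hrefl _ _) (htens0r _ _).
Qed.

Lemma den_widen w m n (f : term m n) r : den w f -> den w (f ⊗ tid r).
Proof.
move/(den_shift 0 r); rewrite /shift (eq_map (g := id)) ?map_id; last by case.
apply: den_heq; exact: htens0l.
Qed.

Lemma den_atom (a : atom gen) : den [:: (0, a)] (aterm a).
Proof.
have e (n : nat) : n = 0 + (n + 0) by lia.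
have [g gE] := hcast R (tid (tgt a)) (e _) erefl.
exists 0, g; split.
  exact: htrans (hsym gE) (hid _ (e _)).
apply: htrans (hsym (hidl _ (hrefl _ _))) (hcomp gE _).
exact: htrans (hsym (htens0r _ _)) (hsym (htens0l _ _)).
Qed.

Lemma den_brw1 n : den (brw1 n) (tbr 1 n).
Proof.
elim: n => [|n IH]; first exact: hbr0r.
have [x xE] := hcast R (tbr 1 1 ⊗ tid n) (erefl (1 + (1 + n))) (erefl (1 + (1 + n))).
have [y yE] := hcast R (tid 1 ⊗ tbr 1 n) (erefl (1 + (1 + n))) (erefl (1 + (n + 1))).
apply: den_heq (hsym (hbr_hexr (n := 1) (hsym xE) (hsym yE))) _.
apply: (@den_cat [:: (0, Pos)]).
  apply: den_heq xE _; exact: (den_widen n (den_atom Pos)).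
apply: den_heq yE _; exact: den_shift0.
Qed.

Lemma den_brw m n : den (brw m n) (tbr m n).
Proof.
elim: m => [|m IH]; first exact: hbr0.
have [x xE] := hcast R (tid 1 ⊗ tbr m n) (erefl (1 + (m + n))) (erefl (1 + (n + m))).
have [y yE] := hcast R (tbr 1 n ⊗ tid m) (erefl (1 + (n + m))) (erefl (n + 1 + m)).
apply: den_heq (hsym (hbr_hexl (m := 1) (hsym xE) (hsym yE))) _.
apply: den_cat; first exact: den_heq xE (den_shift0 _ _).
exact: den_heq yE (den_widen _ (den_brw1 _)).
Qed.

Lemma hinv_uniq m n (f : term m n) (g h : term n m) :
  g ∘ f ≡ tid m -> f ∘ h ≡ tid n -> g ≡ h.
Proof.
move=> gf fh; apply: htrans (hsym (hidr _ fh)) _.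
exact: htrans (hassoc _ _ _ _) (hidl _ gf).
Qed.

Lemma hcancel m n (f : term m n) (g : term n m) k (x : term n k) (y : term k n) :
  f ∘ g ≡ tid n -> x ∘ y ≡ tid k -> (x ∘ f) ∘ (g ∘ y) ≡ tid k.
Proof.
move=> fg xy; apply: htrans (hsym (hassoc _ _ _ _)) _.
apply: htrans (hcomp (hrefl _ _) (hassoc _ _ _ _)) _.
exact: htrans (hcomp (hrefl _ _) (hidl _ fg)) xy.
Qed.

Lemma den_brwV1 n : den (brwV1 n) (tbrV 1 n).
Proof.
elim: n => [|n IH].
  have [b bE] := hcast R (@tbrV gen 1 0) (erefl _) (erefl 1).
  apply: (htrans bE); apply: htrans (hsym (hidr _ (hbr0r 1))) _.
  exact: htrans (hcomp (hsym bE) (hrefl _ _)) (Hteq (teq_brV_br R 1 0)).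
have [x xE] := hcast R (tbr 1 1 ⊗ tid n) (erefl (1 + (1 + n))) (erefl (1 + (1 + n))).
have [y yE] := hcast R (tid 1 ⊗ tbr 1 n) (erefl (1 + (1 + n))) (erefl (1 + (n + 1))).
have bE := hbr_hexr (n := 1) (hsym xE) (hsym yE).
have [x' xE'] := hcast R (tbrV 1 1 ⊗ tid n) (erefl (1 + (1 + n))) (erefl (1 + (1 + n))).
have [y' yE'] := hcast R (tid 1 ⊗ tbrV 1 n) (erefl (1 + (n + 1))) (erefl (1 + (1 + n))).
have H : tbrV 1 (1 + n) ≡ x' ∘ y'.
  apply: (@hinv_uniq _ _ (tbr 1 (1 + n))); first exact: Hteq (teq_brV_br R 1 _).
  apply: htrans (hcomp bE (hrefl _ _)) (hcancel _ _).
    apply: htrans (hcomp (hsym xE) (hsym xE')) _.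
    apply: htrans (hsym (htensr _ _ _ _)) _.
    apply: htrans (htens (Hteq (teq_br_brV R 1 1)) (hrefl _ _)) _.
    exact: htensid.
  apply: htrans (hcomp (hsym yE) (hsym yE')) _.
  apply: htrans (hsym (htensl _ _ _ _)) _.
  apply: htrans (htens (hrefl _ _) (Hteq (teq_br_brV R 1 n))) _.
  exact: htensid.
apply: den_heq (hsym H) _; apply: den_cat.
  exact: den_heq yE' (den_shift0 _ _).
apply: den_heq xE' _; exact: (den_widen n (den_atom Neg)).
Qed.

Lemma den_brwV m n : den (brwV m n) (tbrV m n).
Proof.
elim: m => [|m IH].
  have [b bE] := hcast R (@tbrV gen 0 n) (addn0 n) (add0n n).
  have [c cE] := hcast R (@tbr gen 0 n) (add0n n) (addn0 n).
  apply: htrans _ (hid _ (esym (addn0 n))).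
  apply: (htrans bE); apply: htrans (hsym (hidr _ (htrans (hsym cE) (hbr0 n)))) _.
  exact: htrans (hcomp (hsym bE) (hsym cE)) (Hteq (teq_brV_br R 0 n)).
have [x xE] := hcast R (tid 1 ⊗ tbr m n) (erefl (1 + (m + n))) (erefl (1 + (n + m))).
have [y yE] := hcast R (tbr 1 n ⊗ tid m) (erefl (1 + (n + m))) (erefl (n + 1 + m)).
have bE := hbr_hexl (m := 1) (hsym xE) (hsym yE).
have [x' xE'] := hcast R (tid 1 ⊗ tbrV m n) (erefl (1 + (n + m))) (erefl (1 + (m + n))).
have [y' yE'] := hcast R (tbrV 1 n ⊗ tid m) (esym (addnA n 1 m)) (erefl (1 + (n + m))).
have [y2 yE2] := hcast R y erefl (esym (addnA n 1 m)).
have H : tbrV (1 + m) n ≡ x' ∘ y'.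
  apply: (@hinv_uniq _ _ (tbr (1 + m) n)); first exact: Hteq (teq_brV_br R _ _).
  apply: htrans (hcomp bE (hrefl _ _)) _.
  apply: htrans (hcomp (hcomp yE2 (hrefl _ _)) (hrefl _ _)) _.
  apply: hcancel.
    apply: htrans (hcomp (hsym xE) (hsym xE')) _.
    apply: htrans (hsym (htensl _ _ _ _)) _.
    apply: htrans (htens (hrefl _ _) (Hteq (teq_br_brV R m n))) _.
    exact: htensid.
  apply: htrans (hcomp (htrans (hsym yE2) (hsym yE)) (hsym yE')) _.
  apply: htrans (hsym (htensr _ _ _ _)) _.
  apply: htrans (htens (Hteq (teq_br_brV R 1 n)) (hrefl _ _)) _.
  apply: htrans (htensid _ _ _) (hid _ _); lia.
apply: den_heq (hsym H) _; apply: den_cat.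
  exact: den_heq yE' (den_widen _ (den_brwV1 _)).
exact: den_heq xE' (den_shift0 _ _).
Qed.

Fixpoint flat m n (f : term m n) : word :=
  match f with
  | @tgen _ _ _ g => [:: (0, Gen g)]
  | @Defs.tid _ _ => [::]
  | @tcomp _ _ _ _ g f => flat f ++ flat g
  | @ttens _ _ n _ _ f g => flat f ++ shift n (flat g)
  | @tbr _ m n => brw m n
  | @tbrV _ m n => brwV m n
  end.

Lemma den_flat m n (f : term m n) : den (flat f) f.
Proof.
elim: m n / f => [m n g|n|l m n g wg f wf|m n p q f wf g wg|m n|m n] /=.
- exact: (den_atom (Gen g)).
- exact: hrefl.
- exact: den_cat.
- apply: den_heq (htens_lr _ _ _) _.
  by apply: den_cat; [apply: den_widen | apply: den_shift0].
- exact: den_brw.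
- exact: den_brwV.
Qed.

End Words.

(** * Certified rewriting of diagrams *)

(** Numbering the generators makes equality of words computable. *)
Class coded (gen : nat -> nat -> Type) := Coded {
  code : forall m n, gen m n -> nat;
  code_inj : forall m n (g : gen m n) m' n' (g' : gen m' n'),
    code g = code g' -> Gen g = Gen g'
}.

Section Search.
Context (gen : nat -> nat -> Type) {gen_coded : coded gen} (R : trel gen).

Local Notation word := (word gen).
Local Notation layer := (nat * atom gen)%type.

Definition acode (a : atom gen) :=
  match a with Pos => 0 | Neg => 1 | Gen _ _ g => (code g).+2 end.

Definition eql (x y : layer) := eqn x.1 y.1 && eqn (acode x.2) (acode y.2).

Fixpoint eqw (v w : word) :=
  match v, w with
  | [::], [::] => true
  | x :: v', y :: w' => eql x y && eqw v' w'
  | _, _ => false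
  end.

Lemma eqwP v w : eqw v w -> v = w.
Proof.
elim: v w => [|[k a] v IH] [|[l b] w] //= /andP[/andP[/= /eqnP-> /eqnP e]].
move/IH->; congr ((_, _) :: _).
case: a b e => [||m n g] [||m' n' g'] //= [].
exact: code_inj.
Qed.

Record rule := Rule {
  rdom : nat; rcod : nat; lhs : term gen rdom rcod; rhs : term gen rdom rcod;
  ruleP : teq R lhs rhs
}.

(** Both ways of permuting two adjacent layers; when the upper one has no input
    and the lower one no output, each side is possible. *)
Definition swaps (x y : layer) : seq (layer * layer) :=
  (if y.1 + src y.2 <= x.1 then
     [:: (y, (x.1 - src y.2 + tgt y.2, x.2))] else [::]) ++
  (if x.1 + tgt x.2 <= y.1 then
     [:: ((y.1 - tgt x.2 + src x.2, y.2), x)] else [::]).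

(** Moves a layer below all the layers of [s], in all possible ways. *)
Fixpoint pull (s : word) (y : layer) : seq (layer * word) :=
  if s is x :: s' then
    List.flat_map (fun ys : layer * word =>
      [seq (z.1, z.2 :: ys.2) | z <- swaps x ys.1]) (pull s' y)
  else [:: (y, [::])].

(** [blk] holds the layers of a pattern found so far.  Whatever can be moved below
    [blk] is: layers kept above obstruct the rest of the pattern, layers below
    never do. *)
Fixpoint flush (pre blk kept post : word) : seq (word * word * word) :=
  if post is y :: post' then
    let moves := List.flat_map (fun p : layer * word =>
      [seq (q, p.2) | q <- pull blk p.1]) (pull kept y) in
    if moves is _ :: _ then
      List.flat_map (fun q : layer * word * word =>
        flush (rcons pre q.1.1) q.1.2 q.2 post') moves
    else flush pre blk (rcons kept y) post'
  else [:: (pre, blk, kept)].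

Fixpoint extract k0 (todo pre blk post rest : word) : seq (word * nat * word) :=
  let k := (head (0, Pos) blk).1 in
  match todo, rest with
  | [::], _ => [:: (pre, k - k0, post ++ rest)]
  | _, [::] => [::]
  | t :: todo', y :: rest' =>
    let hits := [seq p <- pull post y | eql p.1 (k + t.1 - k0, t.2)] in
    List.flat_map (fun p : layer * word =>
      List.flat_map (fun q => extract k0 todo' q.1.1 q.1.2 q.2 rest')
        (flush pre (rcons blk p.1) [::] p.2)) hits ++
    List.flat_map (fun q => extract k0 todo q.1.1 q.1.2 q.2 rest')
      (flush pre blk [::] (rcons post y))
  end.

Fixpoint postpone1 (x : layer) (w : word) : word :=
  if w is y :: w' then
    if ohead (rev (swaps x y)) is Some z then z.1 :: postpone1 z.2 w'
    else x :: w
  else [:: x].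

(** Moves every layer up as far as possible.  Searching this form as well finds
    patterns one of whose units the sorted form has created too early, on the
    wrong side of another layer. *)
Definition postpone (w : word) : word := foldr postpone1 [::] w.

(** Candidate decompositions of [w] around the pattern [l].  An empty pattern, that
    is an identity to be expanded, occurs everywhere. *)
Definition occurrences m (l w : word) : seq (word * nat * word) :=
  if l is t :: l' then
    List.flat_map (fun i =>
      let x := nth (0, Pos) w i in
      if eqn (acode t.2) (acode x.2)
      then
        let j :=
          find (fun j => ~~ nilp (pull (drop j (take i w)) x)) (iota 0 i) in
        List.flat_map (fun p : layer * word =>
          List.flat_map (fun q => extract t.1 l' q.1.1 q.1.2 q.2 (drop i.+1 w))
            (flush (take j w) [:: p.1] [::] p.2))
          (pull (drop j (take i w)) x)
      else [::])
      (iota 0 (size w))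
  else
    List.flat_map (fun i => [seq (take i w, k, drop i w) |
      k <- iota 0 (width m (take i w)).+1]) (iota 0 (size w).+1).

(** Nothing is assumed of the candidates: each one is kept only if it has the same
    normal form as [w] when the pattern is put back. *)
Definition rewrites m (r : rule) (w : word) : seq word :=
  let wl := norm (flat (lhs r)) in
  let wr := norm (flat (rhs r)) in
  List.flat_map (fun x : word * nat * word =>
    let: (p, k, q) := x in
    if (k + rdom r <= width m p) && eqw (norm (p ++ shift k wl ++ q)) w
    then [:: norm (p ++ shift k wr ++ q)] else [::])
    (occurrences m wl w ++
     if nilp wl then [::] else occurrences m (postpone wl) (postpone w)).

Fixpoint nub (ws : seq word) : seq word :=
  if ws is w :: ws' then
    let vs := nub ws' in if List.existsb (eqw w) vs then vs else w :: vs
  else [::].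

Fixpoint reach m (rs : seq rule) (ws : seq word) : seq word :=
  if rs is r :: rs' then reach m rs' (nub (List.flat_map (rewrites m r) ws))
  else ws.

(** The rules are applied once each, in the given order, at all places. *)
Definition derives m (rs : seq rule) (v w : word) :=
  let w' := norm w in List.existsb (eqw w') (reach m rs [:: norm v]).

Lemma den_rewrites m n (f : term gen m n) r w w' :
  den R w f -> List.In w' (rewrites m r w) -> den R w' f.
Proof.
move=> wf /List.in_flat_map[[[p k] q] [_]].
case: ifP => // /andP[le /eqwP e] [<-|//].
apply: (proj1 (den_norm _ _ _)); apply: (den_replace (ruleP r) _ _ le).
- exact: (proj1 (den_norm _ _ _) (den_flat _ _)).
- exact: (proj1 (den_norm _ _ _) (den_flat _ _)).
by apply: (proj2 (den_norm _ _ _)); rewrite e.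
Qed.

Lemma nub_sub ws w : List.In w (nub ws) -> List.In w ws.
Proof.
elim: ws => //= v ws IH; case: ifP => _; first by move/IH; right.
by case=> [->|/IH]; [left | right].
Qed.

Lemma derivesP m n (f g : term gen m n) rs :
  derives m rs (flat f) (flat g) -> teq R f g.
Proof.
move=> /List.existsb_exists[w [wr /eqwP e]].
have: den R w f; last first.
  rewrite -e => /(proj2 (den_norm _ _ _)) gf; apply: hteqP.
  exact: den_fun gf (den_flat R g).
have: forall v, List.In v [:: norm (flat f)] -> den R v f.
  by move=> v [<-|//]; apply: (proj1 (den_norm _ _ _)); apply: den_flat.
elim: rs [:: norm (flat f)] wr {e} => [|r rs IH] ws /= wr H; first exact: H.
apply: IH wr _ => v /nub_sub/List.in_flat_map[u [/H uf]].
exact: den_rewrites.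
Qed.

End Search.

Arguments Rule {gen R rdom rcod lhs rhs} ruleP.

(** Rules are given as the proofs of their equations. *)
Notation "[ 'rules' x ; .. ; y ]" :=
  (cons (Rule x) .. (cons (Rule y) nil) ..) (only parsing).

Lemma step_trans gen (C : coded gen) (R : trel gen) m n
    (f g h : term gen m n) rs :
  derives (R := R) m rs (flat f) (flat g) -> teq R g h -> teq R f h.
Proof. by move/derivesP/teq_trans; apply. Qed.

Lemma back_trans gen (C : coded gen) (R : trel gen) m n
    (f g h : term gen m n) rs :
  derives (R := R) m rs (flat g) (flat f) -> teq R g h -> teq R f h.
Proof. by move/derivesP/teq_sym/teq_trans; apply. Qed.

(* [step g using rs] rewrites the left-hand side of the goal into [g];
   [back g using rs] rewrites [g] into the left-hand side; [finish rs] rewrites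
   the left-hand side into the right-hand side. *)
Ltac verify := vm_compute; exact erefl.

Tactic Notation "step" uconstr(g) "using" uconstr(rs) :=
  refine (@step_trans _ _ _ _ _ _ g _ rs _ _);
  [verify | try exact (teq_refl _ _)].

Tactic Notation "back" uconstr(g) "using" uconstr(rs) :=
  refine (@back_trans _ _ _ _ _ _ g _ rs _ _);
  [verify | try exact (teq_refl _ _)].

Tactic Notation "finish" uconstr(rs) :=
  refine (@derivesP _ _ _ _ _ _ _ rs _); verify.

Notation slide f g := (teq_br_nat _ f g).
Notation sym := teq_sym.

Lemma slideV gen (R : trel gen) m m' n n'
    (f : term gen m m') (g : term gen n n') :
  teq R (tbrV m' n' ∘ (g ⊗ f)) ((f ⊗ g) ∘ tbrV m n).
Proof.
have E : teq R ((g ⊗ f) ∘ (tbr m n ∘ tbrV m n))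
    (tbr m' n' ∘ ((f ⊗ g) ∘ tbrV m n)).
  apply: teq_trans (teq_comp_assoc _ _ _ _) _.
  apply: teq_trans (teq_comp (teq_sym (teq_br_nat R f g)) (teq_refl _ _)) _.
  exact: teq_sym (teq_comp_assoc _ _ _ _).
apply: teq_trans (teq_comp (teq_refl _ _) (teq_sym (teq_comp_idr _ _))) _.
apply: teq_trans (teq_comp (teq_refl _ _)
  (teq_comp (teq_refl _ _) (teq_sym (teq_br_brV R m n)))) _.
apply: teq_trans (teq_comp (teq_refl _ _) E) _.
apply: teq_trans (teq_comp_assoc _ _ _ _) _.
apply: teq_trans (teq_comp (teq_brV_br R m' n') (teq_refl _ _)) _.
exact: teq_comp_idl.
Qed.

(** * Functors defined on generators *)

Section Substitution.
Variables (gen gen' : nat -> nat -> Type).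
Variable s : forall m n, gen m n -> term gen' m n.

Fixpoint subst m n (f : term gen m n) : term gen' m n :=
  match f with
  | tgen _ _ g => s g
  | tid n => @tid _ n
  | tcomp _ _ _ g f => subst g ∘ subst f
  | ttens _ _ _ _ f g => subst f ⊗ subst g
  | tbr m n => @tbr _ m n
  | tbrV m n => @tbrV _ m n
  end.

Lemma subst_tcast m n (e : m = n) : subst (tcast gen e) = tcast gen' e.
Proof. by case: _ / e. Qed.

Lemma subst_teq (R : trel gen) (R' : trel gen') :
    (forall m n (f g :
    term gen m n), R m n f g -> teq R' (subst f) (subst g)) ->
  forall m n (f g : term gen m n), teq R f g -> teq R' (subst f) (subst g).
Proof.
move=> RR' m n f g; elim=> {m n f g} /=;
  try by [move=> *; rewrite ?subst_tcast; constructor].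
- by move=> m n f g /RR'.
- by move=> m n f g h _ fg _; apply: teq_trans.
Qed.

End Substitution.

Lemma subst_inverse gen gen' (R : trel gen)
    (s : forall m n, gen m n -> term gen' m n)
    (t : forall m n, gen' m n -> term gen m n) :
    (forall m n (g : gen m n), teq R (subst t (s m n g)) (tgen g)) ->
  forall m n (f : term gen m n), teq R (subst t (subst s f)) f.
Proof.
move=> st m n f;
    elim: m n / f => /= [m n g|*|l m n g Hg f Hf|m n p q f Hf g Hg|*|*].
- exact: st.
- exact: teq_refl.
- exact: teq_comp.
- exact: teq_tens.
- exact: teq_refl.
- exact: teq_refl.
Qed.

Section Functors.
Variables (gen gen' : nat -> nat -> Type) (R : trel gen) (R' : trel gen').
Variable s : forall m n, gen m n -> term gen' m n.
Hypothesis sP : forall m n (f g : term gen m n),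
  teq R f g -> teq R' (subst s f) (subst s g).

Definition subst_functor : functor (free_bsmcat R) (free_bsmcat R') :=
  @Functor (free_bsmcat R) (free_bsmcat R') id (subst s) sP
    (fun a => teq_refl R' (@tid gen' a)) (fun a b c g f => teq_refl R' _).

(** [rewrite] does not see through the coercions on its own. *)
Lemma eqhomE gen0 (R0 : trel gen0) (a b : nat) (e : a = b) :
  @eqhom (free_bsmcat R0) a b e = tcast gen0 e.
Proof. by []. Qed.

Lemma comp_id2 a : teq R' (@tid gen' a ∘ @tid gen' a) (@tid gen' a).
Proof. exact: teq_comp_idl. Qed.

Lemma comp_id_tens m n p (f : term gen' (m + n) p) :
  teq R' (f ∘ @tid gen' _ ∘ (@tid gen' m ⊗ @tid gen' n)) f.
Proof.
apply: teq_trans (teq_comp (teq_comp_idr _ _) (teq_tens_id _ _ _)) _.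
exact: teq_comp_idr.
Qed.

Definition subst_bmfunctor : bmfunctor (free_bsmcat R) (free_bsmcat R').
Proof.
refine (@BMFunctor (free_bsmcat R) (free_bsmcat R') subst_functor
  (fun a b => @tid gen' (a + b)) (fun a b => @tid gen' (a + b))
  (@tid gen' 0) (@tid gen' 0) _ _ _ _ _ _ _ _ _) => /=.
- by move=> a b; apply: comp_id2.
- by move=> a b; apply: comp_id2.
- exact: comp_id2.
- exact: comp_id2.
- move=> a a' b b' f g.
  exact: teq_trans (teq_comp_idl _ _) (sym (teq_comp_idr _ _)).
- move=> a b c; rewrite eqhomE subst_tcast.
  apply: teq_trans (comp_id_tens _) (sym _).
  apply: teq_trans (teq_comp (teq_comp (teq_refl _ _) (teq_tens_id _ _ _)) (teq_refl _ _)) _.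
  exact: teq_trans (teq_comp (comp_id2 _) (teq_refl _ _)) (teq_comp_idl _ _).
- by move=> a; rewrite eqhomE subst_tcast; apply: comp_id_tens.
- by move=> a; rewrite eqhomE subst_tcast; apply: comp_id_tens.
- move=> a b; exact: teq_trans (teq_comp_idr _ _) (sym (teq_comp_idl _ _)).
Defined.

End Functors.

(** * Consequences of the common relations *)

Definition common_code m n (g : common_gen m n) : nat :=
  match g with
  | Mu => 0 | Eta => 1 | Delta => 2 | Eps => 3 | Anti => 4 | AntiV => 5
  | Vp => 6 | Vm => 7 | W => 8
  end.

#[local] Instance common_coded : coded common_gen.
Proof.
by exists common_code => m n g m' n' g'; case: g; case: g'.
Defined.

Section Common.
Local Notation crel := (common_rel (fun _ _ g => g)).
Local Notation mu := (@tgen common_gen 2 1 Mu).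
Local Notation eta := (@tgen common_gen 0 1 Eta).
Local Notation delta := (@tgen common_gen 1 2 Delta).
Local Notation eps := (@tgen common_gen 1 0 Eps).
Local Notation S := (@tgen common_gen 1 1 Anti).
Local Notation SV := (@tgen common_gen 1 1 AntiV).
Local Notation vp := (@tgen common_gen 0 1 Vp).
Local Notation vm := (@tgen common_gen 0 1 Vm).
Local Notation w := (@tgen common_gen 0 2 W).
Local Notation id1 := (@tid common_gen 1).
Local Notation id2 := (@tid common_gen 2).
Local Notation c := (@tbr common_gen 1 1).
Local Notation cV := (@tbrV common_gen 1 1).
Local Notation "f ≈ g" := (teq crel f g) : term_scope.

(* Suffixes: A for associativity, 1l and 1r for unit laws, M and E for the
   behaviour on μ and η, D for the behaviour under Δ, C for centrality. *)
Definition muA : teq crel _ _ := teq_rel (mu_assoc _).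
Definition mu1l : teq crel _ _ := teq_rel (mu_unitl _).
Definition mu1r : teq crel _ _ := teq_rel (mu_unitr _).
Definition deltaA : teq crel _ _ := teq_rel (delta_coassoc _).
Definition delta1l : teq crel _ _ := teq_rel (delta_counitl _).
Definition delta1r : teq crel _ _ := teq_rel (delta_counitr _).
Definition deltaM : teq crel _ _ := teq_rel (delta_mu _).
Definition epsM : teq crel _ _ := teq_rel (eps_mu _).
Definition deltaE : teq crel _ _ := teq_rel (delta_eta _).
Definition epsE : teq crel _ _ := teq_rel (eps_eta _).
Definition Sl : teq crel _ _ := teq_rel (antil _).
Definition Sr : teq crel _ _ := teq_rel (antir _).
Definition SSV : teq crel _ _ := teq_rel (anti_antiV _).
Definition SVS : teq crel _ _ := teq_rel (antiV_anti _).
Definition vpC : teq crel _ _ := teq_rel (vp_central _).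
Definition vpvm : teq crel _ _ := teq_rel (vp_vm _).
Definition epsVp : teq crel _ _ := teq_rel (eps_vp _).
Definition SVp : teq crel _ _ := teq_rel (anti_vp _).
Definition wE : teq crel _ _ := teq_rel (w_def _).
Definition wD : teq crel _ _ := teq_rel (w_delta _).

Lemma anti_eta : S ∘ eta ≈ eta.
Proof.
step (mu ∘ (S ⊗ id1) ∘ (eta ⊗ eta)) using [rules sym mu1r].
finish [rules sym deltaE; Sl; epsE].
Qed.

(** For the convolution product of morphisms H ⊗ H -> H, the left-hand side is a left
    inverse of μ and the right-hand side a right inverse.  The first diagram below
    is S((x_1 y_1)_1) (x_1 y_1)_2 S(y_2) S(x_2). *)
Lemma anti_mu : S ∘ mu ≈ mu ∘ c ∘ (S ⊗ S).
Proof.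
apply: sym.
back (mu ∘ ((mu ∘ (S ⊗ id1) ∘ delta ∘ mu) ⊗ (mu ∘ c ∘ (S ⊗ S)))
    ∘ (id1 ⊗ c ⊗ id1) ∘ (delta ⊗ delta)) using
  [rules Sl; epsM; sym (slide id1 eps); delta1l; delta1l; mu1l].
step (mu ∘ ((S ∘ mu) ⊗ (mu ∘ (id1 ⊗ S))) ∘ (id1 ⊗ c ⊗ id1)
    ∘ (id2 ⊗ c) ∘ (id1 ⊗ delta ⊗ id1) ∘ (delta ⊗ id1)) using
  [rules sym deltaM; sym (slide id1 delta); deltaA; deltaA; muA; muA; sym muA;
   slide S S; slide id1 delta; Sr; mu1l; sym (slide id1 eps); delta1r].
finish [rules slide delta id1; Sr; mu1r; sym (slide eps id1); delta1r].
Qed.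

(** The proof of [anti_mu] turned upside down. *)
Lemma delta_anti : delta ∘ S ≈ (S ⊗ S) ∘ c ∘ delta.
Proof.
apply: sym.
back ((mu ⊗ mu) ∘ (id1 ⊗ c ⊗ id1)
    ∘ ((delta ∘ mu ∘ (S ⊗ id1) ∘ delta) ⊗ ((S ⊗ S) ∘ c ∘ delta)) ∘ delta) using
  [rules Sl; deltaE; slide eta id1; mu1l; mu1l; delta1l].
step ((mu ⊗ id1) ∘ (id1 ⊗ mu ⊗ id1) ∘ (id2 ⊗ c) ∘ (id1 ⊗ c ⊗ id1)
    ∘ ((delta ∘ S) ⊗ ((id1 ⊗ S) ∘ delta)) ∘ delta) using
  [rules sym deltaM; slide mu id1; muA; muA; deltaA; deltaA; sym deltaA;
   sym (slide S S); sym (slide mu id1); Sr; delta1l; slide eta id1; mu1r].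
finish [rules sym (slide id1 mu); Sr; delta1r; slide id1 eta; mu1r].
Qed.

Lemma vm_vp : mu ∘ (vm ⊗ vp) ≈ eta.
Proof. finish [rules sym vpC; vpvm]. Qed.

Lemma vm_central : mu ∘ (vm ⊗ id1) ≈ mu ∘ (id1 ⊗ vm).
Proof.
step (mu ∘ (mu ⊗ id1) ∘ (mu ⊗ id2) ∘ (vm ⊗ id1 ⊗ vp ⊗ vm)) using
  [rules sym mu1r; sym vpvm; sym muA].
finish [rules muA; sym vpC; sym muA; vm_vp; mu1l].
Qed.

Lemma anti_vm : S ∘ vm ≈ vm.
Proof.
step (mu ∘ (mu ⊗ id1) ∘ ((S ∘ vm) ⊗ vp ⊗ vm)) using
  [rules sym mu1r; sym vpvm; sym muA].
finish [rules sym SVp; sym (slide vp vm); sym (slide S S); sym anti_mu; vpvm;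
    anti_eta; mu1l].
Qed.

Lemma eps_vm : eps ∘ vm ≈ tid 0.
Proof.
step ((eps ⊗ eps) ∘ (vp ⊗ vm)) using [rules sym epsVp].
finish [rules sym epsM; vpvm; epsE].
Qed.

Lemma eps_w_l : (eps ⊗ id1) ∘ w ≈ eta.
Proof. finish [rules wE; epsM; eps_vm; delta1l; vpvm]. Qed.

Lemma eps_w_r : (id1 ⊗ eps) ∘ w ≈ eta.
Proof. finish [rules wE; epsM; eps_vm; delta1r; vm_vp]. Qed.

Lemma delta_vp : delta ∘ vp ≈ (mu ⊗ mu) ∘ (vp ⊗ w ⊗ vp).
Proof.
apply: sym; finish [rules wE; sym muA; vpvm; muA; vm_vp; mu1l; mu1r].
Qed.

Lemma anti_mul_vm : S ∘ mu ∘ (vm ⊗ id1) ≈ mu ∘ (vm ⊗ id1) ∘ S.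
Proof. finish [rules anti_mu; anti_vm; slide vm id1; sym vm_central]. Qed.

(** S is an antimorphism of coalgebras fixing v_+, and w is Δv_+ up to central
    factors v_-. *)
Lemma w_sym : (S ⊗ S) ∘ c ∘ w ≈ w.
Proof.
step ((mu ⊗ mu) ∘ (vm ⊗ ((S ⊗ S) ∘ c ∘ delta ∘ vp) ⊗ vm)) using
  [rules wE; slide (mu ∘ (vm ⊗ id1)) (mu ∘ (id1 ⊗ vm)); sym vm_central;
   anti_mul_vm; anti_mul_vm; vm_central].
finish [rules sym delta_anti; SVp; sym wE].
Qed.

Lemma anti_mu_op : mu ∘ (S ⊗ S) ≈ S ∘ mu ∘ cV.
Proof.
back (mu ∘ c ∘ cV ∘ (S ⊗ S)) using [rules teq_br_brV _ 1 1].
finish [rules slideV _ S S; sym anti_mu].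
Qed.

(** The image of [wD] under the symmetry [w_sym]; the rest of the proof compares two
    braids. *)
Lemma w_delta_l : (delta ⊗ id1) ∘ w ≈ (id2 ⊗ mu) ∘ (id1 ⊗ w ⊗ id1) ∘ w.
Proof.
step ((S ⊗ S ⊗ (S ∘ mu)) ∘ (id1 ⊗ c ⊗ id1) ∘ (c ⊗ c) ∘ (id2 ⊗ w) ∘ w) using
  [rules sym w_sym; delta_anti; sym (slide id1 delta); wD; slide mu id2;
   sym (slide id2 c); slide w id1].
back ((S ⊗ S ⊗ (S ∘ mu)) ∘ (id2 ⊗ cV) ∘ (id1 ⊗ c ⊗ id1)
    ∘ (id1 ⊗ w ⊗ id1) ∘ c ∘ w) using
  [rules sym (slide id1 w); sym (slide id1 c); teq_brV_br _ 1 1].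
finish [rules sym anti_mu_op; w_sym; w_sym].
Qed.

(** For the product (a ⊗ b)(a' ⊗ b') = a a' ⊗ b' b, where the second pair is
    nested inside the first, the left-hand side is a right inverse of w by
    [w_delta_l] and the right-hand side is a left inverse by [wD]. *)
Lemma w_anti : (S ⊗ id1) ∘ w ≈ (id1 ⊗ S) ∘ w.
Proof.
apply: sym.
back ((mu ⊗ mu) ∘ (id1 ⊗ ((((mu ∘ (id1 ⊗ S) ∘ delta) ⊗ id1)) ∘ w) ⊗ id1)
    ∘ (id1 ⊗ S) ∘ w) using
  [rules Sr; eps_w_l; mu1r; mu1l].
finish [rules w_delta_l; sym muA; muA; sym wD; Sr; eps_w_r; mu1l; mu1r].
Qed.

(** In symbols, x_1 y ⊗ x_2 = (x y_1)_1 ⊗ (x y_1)_2 S(y_2). *)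
Lemma shear : (mu ⊗ id1) ∘ (id1 ⊗ c) ∘ (delta ⊗ id1) ≈
  (id1 ⊗ mu) ∘ ((delta ∘ mu) ⊗ S) ∘ (id1 ⊗ delta).
Proof.
by apply: sym; finish [rules sym deltaM; deltaA; muA; Sr; delta1r; mu1r].
Qed.

(* The product of the braided tensor square of H. *)
Local Notation M := ((mu ⊗ mu) ∘ (id1 ⊗ c ⊗ id1)).

Lemma mul2A : M ∘ (M ⊗ id2) ≈ M ∘ (id2 ⊗ M).
Proof. finish [rules slide mu id1; muA; muA; sym (slide id1 mu)]. Qed.

Lemma antiV_eta : SV ∘ eta ≈ eta.
Proof. finish [rules sym anti_eta; SVS]. Qed.

Lemma antiV_vm : SV ∘ vm ≈ vm.
Proof. finish [rules sym anti_vm; SVS]. Qed.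

Lemma antiV_vp : SV ∘ vp ≈ vp.
Proof. finish [rules sym SVp; SVS]. Qed.

Lemma w_antiV : (SV ⊗ id1) ∘ w ≈ (id1 ⊗ SV) ∘ w.
Proof. finish [rules sym SVS; sym w_anti; SVS]. Qed.

(** S^{-1} is an antipode for the product μ c^{-1}. *)
Lemma antiV_op : mu ∘ (id1 ⊗ SV) ∘ cV ∘ delta ≈ eta ∘ eps.
Proof.
step (SV ∘ mu ∘ c ∘ (S ⊗ (S ∘ SV)) ∘ cV ∘ delta) using [rules sym SVS; anti_mu].
finish [rules SSV; slide S id1; teq_br_brV _ 1 1; Sr; antiV_eta].
Qed.

Lemma slide_under_w : (c ⊗ id1) ∘ (id1 ⊗ w) ≈ (id1 ⊗ cV) ∘ (w ⊗ id1).
Proof.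
back ((id1 ⊗ (cV ∘ c)) ∘ (c ⊗ id1) ∘ (id1 ⊗ w)) using [rules teq_brV_br _ 1 1].
finish [rules slide id1 w].
Qed.

(* The inverse of Δv_+ in the braided tensor square. *)
Local Notation X := ((mu ⊗ mu) ∘ (vm ⊗ ((id1 ⊗ SV) ∘ w) ⊗ vm)).

Lemma mul_vp_vm : mu ∘ (mu ⊗ mu) ∘ (vp ⊗ id1 ⊗ vm ⊗ id1) ≈ mu.
Proof. finish [rules sym muA; muA; sym vm_central; sym muA; vpvm; mu1l]. Qed.

Lemma mul_vp_vm_r : mu ∘ (mu ⊗ mu) ∘ (id1 ⊗ vp ⊗ id1 ⊗ vm) ≈ mu.
Proof. finish [rules sym muA; muA; vpC; sym muA; muA; vpvm; mu1r]. Qed.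

(** The factors v_± cancel; the second copy of w is then brought inside the first one,
    where [wD] applies. *)
Lemma delta_vp_inv : M ∘ ((delta ∘ vp) ⊗ X) ≈ eta ⊗ eta.
Proof.
step ((mu ⊗ mu) ∘ (id1 ⊗ c ⊗ SV) ∘ (w ⊗ w)) using
  [rules delta_vp; slide (mu ∘ (id1 ⊗ vp)) (mu ∘ (vm ⊗ id1)); mul_vp_vm;
    mul_vp_vm_r].
step ((mu ⊗ (mu ∘ (id1 ⊗ SV) ∘ cV)) ∘ (id1 ⊗ w ⊗ id1) ∘ w) using
  [rules slide_under_w].
finish [rules sym wD; antiV_op; eps_w_r].
Qed.

(** Both sides are inverse to Δv_+ in the braided tensor square. *)
Lemma delta_vm : delta ∘ vm ≈ X.
Proof.
step (M ∘ (id2 ⊗ M) ∘ ((delta ∘ vm) ⊗ (delta ∘ vp) ⊗ X)) using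
  [rules sym mu1r; sym mu1r; sym (slide id1 eta); sym delta_vp_inv].
finish [rules sym mul2A; deltaM; vm_vp; deltaE; slide eta id1; mu1l; mu1l].
Qed.

Lemma antiV_mul_vm : SV ∘ mu ∘ (id1 ⊗ vm) ≈ mu ∘ (id1 ⊗ vm) ∘ SV.
Proof.
step (SV ∘ mu ∘ ((S ∘ SV) ⊗ vm)) using [rules sym SSV].
finish [rules sym vm_central; sym anti_mul_vm; SVS; vm_central].
Qed.

(** In Δv = v w' ⊗ S^{-1}(w'') v, powers of S may be moved from one leg of w to the
    other. *)
Lemma delta_vm_twist : (S ⊗ SV) ∘ delta ∘ vm ≈ delta ∘ vm.
Proof.
finish [rules delta_vm; anti_mul_vm; antiV_mul_vm; sym w_antiV; SSV;
    sym delta_vm].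
Qed.

Lemma vp_delta_vm : (mu ⊗ id1) ∘ (vp ⊗ (delta ∘ vm)) ≈
    (id1 ⊗ (mu ∘ (SV ⊗ vm))) ∘ w.
Proof. finish [rules delta_vm; sym muA; vpvm; mu1l]. Qed.

(** In symbols, x_1 ⊗ v x_2 = v_+ w' z_1 ⊗ w'' z_2 with z = v x, where w'' crosses
    z_1: write x = v_+ z and expand Δv_+ through w. *)
Lemma delta_mul_vm_r : (id1 ⊗ (mu ∘ (vm ⊗ id1))) ∘ delta ≈
  (mu ⊗ id1) ∘ (vp ⊗ (M ∘ (w ⊗ (delta ∘ mu ∘ (vm ⊗ id1))))).
Proof.
step ((id1 ⊗ (mu ∘ (vm ⊗ id1))) ∘ delta ∘ mu ∘ (vp ⊗ (mu ∘ (vm ⊗ id1)))) using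
  [rules sym mu1l; sym vpvm; muA].
step ((id1 ⊗ (mu ∘ (vm ⊗ (mu ∘ (vp ⊗ mu))))) ∘ (mu ⊗ id2) ∘ (mu ⊗ id1 ⊗ id2) ∘
  (id2 ⊗ c ⊗ id1) ∘ (vp ⊗ w ⊗ (delta ∘ mu ∘ (vm ⊗ id1)))) using
  [rules sym deltaM; delta_vp; sym vpC; slide (mu ∘ (vp ⊗ id1)) id1; muA].
finish [rules sym muA; vm_vp; mu1l; muA].
Qed.

Lemma delta_vm_c : c ∘ delta ∘ vm ≈ (SV ⊗ SV) ∘ delta ∘ vm.
Proof. apply: sym; finish [rules sym anti_vm; delta_anti; SVS; SVS]. Qed.

End Common.

(** * From the Habiro pairing to the integrals *)

Definition habiro_code m n (g : habiro_gen m n) : nat :=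
  if g is HCommon _ _ h then common_code h else 9.

#[local] Instance habiro_coded : coded habiro_gen.
Proof.
exists habiro_code => m n g m' n' g'.
by case: g => [? ? []|]; case: g' => [? ? []|].
Defined.

Definition in_habiro m n (g : common_gen m n) : term habiro_gen m n :=
  tgen (HCommon g).

Lemma habiro_of_common m n (f g : term common_gen m n) :
  teq (common_rel (fun _ _ g => g)) f g ->
  teq habiro_rel (subst in_habiro f) (subst in_habiro g).
Proof.
apply: subst_teq => {}m {}n {}f {}g H; apply/teq_rel/habiro_common.
by case: H; constructor.
Qed.

Section Habiro.
Local Notation com := habiro_of_common.
Local Notation mu := (@tgen habiro_gen 2 1 (HCommon Mu)).
Local Notation eta := (@tgen habiro_gen 0 1 (HCommon Eta)).
Local Notation delta := (@tgen habiro_gen 1 2 (HCommon Delta)).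
Local Notation eps := (@tgen habiro_gen 1 0 (HCommon Eps)).
Local Notation S := (@tgen habiro_gen 1 1 (HCommon Anti)).
Local Notation SV := (@tgen habiro_gen 1 1 (HCommon AntiV)).
Local Notation vp := (@tgen habiro_gen 0 1 (HCommon Vp)).
Local Notation vm := (@tgen habiro_gen 0 1 (HCommon Vm)).
Local Notation w := (@tgen habiro_gen 0 2 (HCommon W)).
Local Notation wbar := (@tgen habiro_gen 2 0 Wbar).
Local Notation id1 := (@tid habiro_gen 1).
Local Notation id2 := (@tid habiro_gen 2).
Local Notation c := (@tbr habiro_gen 1 1).
Local Notation cV := (@tbrV habiro_gen 1 1).
Local Notation M := ((mu ⊗ mu) ∘ (id1 ⊗ c ⊗ id1)).
Local Notation "f ≈ g" := (teq habiro_rel f g) : term_scope.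

Definition wbar_zigzag_l : teq habiro_rel _ _ := teq_rel wbar_w.
Definition wbar_vpvpvp : teq habiro_rel _ _ := teq_rel wbar_vp.

(* The pairing obtained from w̄ by the symmetry of w. *)
Local Notation wbar' := (wbar ∘ cV ∘ (SV ⊗ SV)).

Lemma wbar'_w : (wbar' ⊗ id1) ∘ (id1 ⊗ w) ≈ id1.
Proof.
step ((wbar ⊗ S) ∘ (cV ⊗ id1) ∘ (id1 ⊗ c) ∘ (SV ⊗ w)) using
  [rules sym (com w_sym); com SVS].
finish [rules sym (slide w id1); slide id1 c; teq_brV_br _ 1 1;
    sym (slide id1 wbar); wbar_zigzag_l; com SSV].
Qed.

(** Two pairings that satisfy opposite zigzag identities with w coincide. *)
Lemma wbar_sym : wbar ≈ wbar'.
Proof.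
apply: sym.
back (wbar' ∘ (id1 ⊗ ((id1 ⊗ wbar) ∘ (w ⊗ id1)))) using [rules wbar_zigzag_l].
finish [rules wbar'_w].
Qed.

Lemma wbar_zigzag_r : (wbar ⊗ id1) ∘ (id1 ⊗ w) ≈ id1.
Proof. finish [rules wbar_sym; wbar'_w]. Qed.

(** Under the duality between w and w̄, the relation [wD] becomes the compatibility
    of w̄ with products on the right. *)
Lemma wbar_mu_r : wbar ∘ (id1 ⊗ mu) ≈ wbar ∘ (id1 ⊗ wbar ⊗ id1) ∘ (delta ⊗ id2).
Proof.
apply: sym.
finish [rules sym wbar_zigzag_r; com wD; wbar_zigzag_l; wbar_zigzag_l].
Qed.

Lemma wbar_mu_l : wbar ∘ (mu ⊗ id1) ≈ wbar ∘ (id1 ⊗ wbar ⊗ id1) ∘ (id2 ⊗ delta).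
Proof.
apply: sym.
finish [rules sym wbar_zigzag_l; com w_delta_l; wbar_zigzag_r; wbar_zigzag_r].
Qed.

Lemma wbar_eta_r : wbar ∘ (id1 ⊗ eta) ≈ eps.
Proof. apply: sym; finish [rules sym wbar_zigzag_r; com eps_w_r]. Qed.

Lemma wbar_anti : wbar ∘ (id1 ⊗ S) ≈ wbar ∘ (S ⊗ id1).
Proof. finish [rules sym wbar_zigzag_l; com w_anti; wbar_zigzag_r]. Qed.

Lemma wbar_antiV : wbar ∘ (id1 ⊗ SV) ≈ wbar ∘ (SV ⊗ id1).
Proof. finish [rules sym wbar_zigzag_l; com w_antiV; wbar_zigzag_r]. Qed.

(* The form w̄(v, -). *)
Local Notation g := (wbar ∘ (vm ⊗ id1)).
Definition hlam : term habiro_gen 1 0 := g ∘ mu ∘ (vm ⊗ id1).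
Definition hLam : term habiro_gen 0 1 := (hlam ⊗ id1) ∘ w.

Lemma hlam_dual : wbar ∘ (hLam ⊗ id1) ≈ hlam.
Proof. finish [rules wbar_zigzag_l]. Qed.

Lemma hlam_anti : hlam ∘ S ≈ hlam.
Proof.
finish [rules sym (com anti_mul_vm); wbar_anti; com anti_vm].
Qed.

Lemma hlam_vp : hlam ∘ vp ≈ tid 0.
Proof. finish [rules com vm_vp; wbar_eta_r; com eps_vm]. Qed.

(** In symbols, S(z_1) w̄(v, z_2) z_3 = η w̄(v, z), where η also fills the slot left
    empty by the scalar w̄(v, z_2).  Pairing both sides with y on the
    left yields w̄(y_1 v S(y_2), z) = ε(y) w̄(v, z): this is the dual form of the
    centrality of v. *)
Lemma coadjoint_invariance : mu ∘ (mu ⊗ id1) ∘ (S ⊗ eta ⊗ id1)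
    ∘ (id1 ⊗ g ⊗ id1) ∘ (delta ⊗ id1) ∘ delta ≈ eta ∘ g.
Proof.
step ((id1 ⊗ wbar) ∘ (id1 ⊗ ((mu ∘ (id1 ⊗ (mu ∘ (vm ⊗ S))) ∘ delta)) ⊗ id1)
    ∘ (w ⊗ id1)) using
  [rules com mu1r; sym wbar_zigzag_l; wbar_mu_r; wbar_anti; sym wbar_mu_l;
    sym wbar_mu_l].
finish [rules com vm_central; sym (com muA); com Sr; com mu1l; com eps_w_r].
Qed.

(** The planar version of this contraction is the identity; here the strand first
    crosses w', and undoing the crossing by the symmetry of w costs S twice. *)
Lemma slide_over_w : (id1 ⊗ wbar) ∘ (c ⊗ id1) ∘ (id1 ⊗ w) ≈ S ∘ S.
Proof.
finish [rules sym (com w_sym); slide id1 S; wbar_anti; sym (slide S id1);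
    sym (slide wbar id1); wbar_zigzag_r].
Qed.

Lemma wbar_slide : (id1 ⊗ wbar) ∘ (c ⊗ id1) ≈ (wbar ⊗ id1) ∘ (id1 ⊗ cV).
Proof. apply: sym; finish [rules slide wbar id1; teq_br_brV _ 1 1]. Qed.

(** Moving Δv out of w produces the square of S on one leg and a crossing; the latter
    is absorbed by Δv = Δ(S v), and what remains is the twist of [delta_vm_twist]. *)
Lemma w_through_vm : (id2 ⊗ wbar) ∘ (id1 ⊗ (delta ∘ vm) ⊗ id1) ∘ w ≈ delta ∘ vm.
Proof.
finish [rules sym (slide (delta ∘ vm) id1); slide_over_w; slide id1 (S ∘ S);
    com delta_vm_c; com SSV; com delta_vm_twist].
Qed.

(** With z = v x, the successive diagrams are
    x_1 λ(x_2) = v_+ w' z_1 w̄(v, w'' z_2) = v_+ v_1 z_1 w̄(v_2, z_2)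
    = w' z_1 w̄(v, z_2) w̄(w'', S^{-1} z_3) = S^{-1}(S(z_1) w̄(v, z_2) z_3),
    where the strands crossing each other are left implicit. *)
Lemma hlam_integral : (id1 ⊗ hlam) ∘ delta ≈ eta ∘ hlam.
Proof.
step ((id1 ⊗ g) ∘ (mu ⊗ id1)
    ∘ (vp ⊗ (M ∘ (w ⊗ (delta ∘ mu ∘ (vm ⊗ id1)))))) using
  [rules com delta_mul_vm_r].
back ((mu ⊗ wbar) ∘ (id1 ⊗ mu ⊗ id2) ∘ (id2 ⊗ c ⊗ id1)
    ∘ (vp ⊗ (delta ∘ vm) ⊗ (delta ∘ mu ∘ (vm ⊗ id1)))) using
  [rules sym w_through_vm; slide (id1 ⊗ wbar) id1; slide (delta ∘ vm) id1;
    sym wbar_mu_r].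
step ((mu ⊗ wbar) ∘ (id1 ⊗ ((c ⊗ g) ∘ (id1 ⊗ delta)) ⊗ id1)
    ∘ (w ⊗ ((id1 ⊗ SV) ∘ delta ∘ mu ∘ (vm ⊗ id1)))) using
  [rules sym (com muA); com vp_delta_vm; slide (mu ∘ (SV ⊗ vm)) id1; wbar_mu_l;
    sym wbar_antiV; sym (com deltaA)].
step (mu ∘ cV ∘ (id1 ⊗ g ⊗ SV) ∘ (delta ⊗ id1) ∘ delta ∘ mu ∘ (vm ⊗ id1)) using
  [rules wbar_slide; wbar_zigzag_l].
step (SV ∘ (mu ∘ (mu ⊗ id1) ∘ (S ⊗ eta ⊗ id1) ∘ (id1 ⊗ g ⊗ id1)
    ∘ (delta ⊗ id1) ∘ delta) ∘ mu ∘ (vm ⊗ id1)) using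
  [rules sym (com SVS); com anti_mu; sym (slideV _ S S); teq_br_brV _ 1 1;
    com SSV; sym (com mu1r)].
finish [rules coadjoint_invariance; com antiV_eta].
Qed.

(** Both integral properties say the same thing, since λ = w̄(Λ, -). *)
Lemma hLam_integral : mu ∘ (hLam ⊗ id1) ≈ hLam ∘ eps.
Proof.
step ((wbar ⊗ id1) ∘ (id1 ⊗ ((id1 ⊗ hlam) ∘ delta) ⊗ id1) ∘ (id1 ⊗ w)) using
  [rules sym wbar_zigzag_r; wbar_mu_l; hlam_dual].
finish [rules hlam_integral; wbar_eta_r].
Qed.

Lemma anti_hLam : S ∘ hLam ≈ hLam.
Proof. finish [rules sym (com w_anti); hlam_anti]. Qed.

Lemma antiV_hLam : SV ∘ hLam ≈ hLam.
Proof. finish [rules sym anti_hLam; com SVS]. Qed.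

(** λ S = λ and S v = v exchange the two legs of Δv. *)
Lemma hlam_delta_vm : (hlam ⊗ id1) ∘ delta ∘ vm ≈ eta ∘ hlam ∘ vm.
Proof.
finish [rules sym (com anti_vm); com delta_anti; hlam_anti;
    sym (slide id1 hlam); hlam_integral; com anti_eta].
Qed.

(** By [delta_vm], v w' ⊗ w'' is Δv up to S^{-1} and v_+ on the second leg, so λ can be
    applied to it as an integral. *)
Lemma fourier_vm : (hlam ⊗ id1) ∘ (mu ⊗ id1) ∘ (vm ⊗ w) ≈ vp ∘ hlam ∘ vm.
Proof.
apply: sym; finish [rules sym (com SVp); sym (com mu1l); sym hlam_delta_vm;
    com delta_vm; com muA; com vm_vp; com mu1r; com SSV].
Qed.

Lemma hlam_mul_vm : (hlam ∘ vm) ⊗ (wbar ∘ (vp ⊗ id1)) ≈ hlam ∘ mu ∘ (vm ⊗ id1).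
Proof. finish [rules sym fourier_vm; wbar_zigzag_l]. Qed.

Lemma antiV_mul_vp_vp : SV ∘ mu ∘ (vp ⊗ vp) ≈ mu ∘ (vp ⊗ vp).
Proof.
finish [rules sym (com SVp); sym (com SVp); com anti_mu_op; com SVS;
  slideV _ vp vp].
Qed.

Lemma wbar_vp_swap : wbar ∘ (vp ⊗ id1) ∘ (mu ∘ (vp ⊗ vp)) ≈ tid 0.
Proof.
apply: sym.
finish [rules sym wbar_vpvpvp; wbar_sym; antiV_mul_vp_vp; com antiV_vp;
    slideV _ vp (mu ∘ (vp ⊗ vp))].
Qed.

(** The left-hand side is a closed diagram, which may be moved next to the strand on
    which [hlam_mul_vm] expects it. *)
Lemma hlam_vm : hlam ∘ vm ≈ tid 0.
Proof.
apply: teq_trans (sym (teq_comp_idr _ _)) _.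
apply: teq_trans (teq_comp (teq_refl _ _) (sym wbar_vp_swap)) _.
apply: teq_trans (teq_comp_assoc _ _ _ _) _.
have scalar_tens (s : term habiro_gen 0 0) (q : term habiro_gen 1 0) :
    s ∘ q ≈ s ⊗ q.
  apply: hteqP; apply: htrans _ (htens_rl _ s q).
  exact: hcomp (hsym (htens0r _ _)) (hsym (htens0l _ _)).
apply: teq_trans (teq_comp (scalar_tens _ _) (teq_refl _ _)) _.
apply: teq_trans (teq_comp hlam_mul_vm (teq_refl _ _)) _.
finish [rules sym (com muA); com vm_vp; com mu1l; hlam_vp].
Qed.

Lemma hlam_hLam : hlam ∘ hLam ≈ tid 0.
Proof.
step (wbar ∘ (vm ⊗ hLam)) using [rules com vm_central; hLam_integral;
    com eps_vm].
step (wbar ∘ (hLam ⊗ vm)) using [rules wbar_sym; com antiV_vm; antiV_hLam;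
    slideV _ hLam vm].
finish [rules hlam_dual; hlam_vm].
Qed.

End Habiro.

(** * From the integrals to the Habiro pairing *)

Definition kerler_code m n (g : kerler_gen m n) : nat :=
  match g with KCommon _ _ h => common_code h | Lam => 9 | BigLam => 10 end.

#[local] Instance kerler_coded : coded kerler_gen.
Proof.
exists kerler_code => m n g m' n' g'.
by case: g => [? ? []||]; case: g' => [? ? []||].
Defined.

Definition in_kerler m n (g : common_gen m n) : term kerler_gen m n :=
  tgen (KCommon g).

Lemma kerler_of_common m n (f g : term common_gen m n) :
  teq (common_rel (fun _ _ g => g)) f g ->
  teq kerler_rel (subst in_kerler f) (subst in_kerler g).
Proof.
apply: subst_teq => {}m {}n {}f {}g H; apply/teq_rel/kerler_common.
by case: H; constructor.
Qed.

Section Kerler.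
Local Notation com := kerler_of_common.
Local Notation mu := (@tgen kerler_gen 2 1 (KCommon Mu)).
Local Notation eta := (@tgen kerler_gen 0 1 (KCommon Eta)).
Local Notation delta := (@tgen kerler_gen 1 2 (KCommon Delta)).
Local Notation eps := (@tgen kerler_gen 1 0 (KCommon Eps)).
Local Notation S := (@tgen kerler_gen 1 1 (KCommon Anti)).
Local Notation vp := (@tgen kerler_gen 0 1 (KCommon Vp)).
Local Notation vm := (@tgen kerler_gen 0 1 (KCommon Vm)).
Local Notation w := (@tgen kerler_gen 0 2 (KCommon W)).
Local Notation lambda := (@tgen kerler_gen 1 0 Lam).
Local Notation Lambda := (@tgen kerler_gen 0 1 BigLam).
Local Notation id1 := (@tid kerler_gen 1).
Local Notation id2 := (@tid kerler_gen 2).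
Local Notation "f ≈ g" := (teq kerler_rel f g) : term_scope.

Definition kwbar : term kerler_gen 2 0 :=
  lambda ∘ mu ∘ (id1 ⊗ (lambda ∘ mu) ⊗ id1) ∘ (w ⊗ id1 ⊗ S).

Local Notation ax r := (teq_rel r : teq kerler_rel _ _).

Lemma w_lam : (id1 ⊗ lambda) ∘ w ≈ Lambda.
Proof.
finish [rules sym (com w_sym); ax lam_anti; sym (slide lambda id1); ax lam_w;
    ax anti_Lam].
Qed.

(** By [shear] and the integral property of Λ, Λ_1 ⊗ Λ_2 S(y) = Λ_1 y ⊗ Λ_2 with y
    crossing Λ_2; then λ is applied to Λ_2. *)
Lemma frobenius : (id1 ⊗ (lambda ∘ mu)) ∘ ((delta ∘ Lambda) ⊗ S) ≈ id1.
Proof.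
finish [rules sym (com delta1l); sym (ax Lam_integral); sym (com shear);
  sym (slide lambda id1); ax lam_integral; ax lam_Lam; com mu1l].
Qed.

Lemma kwbar_w : (id1 ⊗ kwbar) ∘ (w ⊗ id1) ≈ id1.
Proof. finish [rules sym (com w_delta_l); w_lam; frobenius]. Qed.

Lemma lam_delta_vp : (lambda ⊗ id1) ∘ delta ∘ vp ≈ eta.
Proof.
finish [rules sym (com SVp); com delta_anti; ax lam_anti;
  sym (slide id1 lambda); ax lam_integral; com anti_eta; ax lam_vp].
Qed.

Lemma kwbar_vp : kwbar ∘ (mu ⊗ vp) ∘ (vp ⊗ vp) ≈ tid 0.
Proof.
finish [rules com SVp; com wE; sym (com vpC); sym (com muA); com vpvm; com mu1l;
  com muA; sym (com muA); com vm_vp; com mu1l; lam_delta_vp; com mu1l;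
  ax lam_vp].
Qed.

Lemma fourier_vp : (lambda ⊗ id1) ∘ (mu ⊗ id1) ∘ (vp ⊗ w) ≈ vm.
Proof.
finish [rules com wE; sym (com muA); com vpvm; com mu1l; lam_delta_vp; com mu1l].
Qed.

Lemma kwbar_vm : kwbar ∘ (vm ⊗ id1) ≈ lambda ∘ mu ∘ (vp ⊗ id1).
Proof. apply: sym; finish [rules sym kwbar_w; fourier_vp]. Qed.

Lemma kwbar_lambda : kwbar ∘ (vm ⊗ id1) ∘ mu ∘ (vm ⊗ id1) ≈ lambda.
Proof. finish [rules kwbar_vm; sym (com muA); com vpvm; com mu1l]. Qed.

End Kerler.

(** * The equivalence *)

Definition kerler_to_habiro m n (g : kerler_gen m n) : term habiro_gen m n :=
  match g with
  | KCommon _ _ h => tgen (HCommon h)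
  | Lam => hlam
  | BigLam => hLam
  end.

Definition habiro_to_kerler m n (g : habiro_gen m n) : term kerler_gen m n :=
  match g with
  | HCommon _ _ h => tgen (KCommon h)
  | Wbar => kwbar
  end.

Lemma kerler_to_habiro_teq m n (f g : term kerler_gen m n) :
  teq kerler_rel f g ->
  teq habiro_rel (subst kerler_to_habiro f) (subst kerler_to_habiro g).
Proof.
apply: subst_teq => {}m {}n {}f {}g; case=> [{}m {}n {}f {}g H||||||| ].
- by apply/teq_rel/habiro_common; case: H; constructor.
- exact: hlam_integral.
- exact: hLam_integral.
- exact: hlam_hLam.
- exact: anti_hLam.
- exact: hlam_anti.
- exact: teq_refl.
- exact: hlam_vp.
Qed.

Lemma habiro_to_kerler_teq m n (f g : term habiro_gen m n) :
  teq habiro_rel f g ->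
  teq kerler_rel (subst habiro_to_kerler f) (subst habiro_to_kerler g).
Proof.
apply: subst_teq => {}m {}n {}f {}g; case=> [{}m {}n {}f {}g H|| ].
- by apply/teq_rel/kerler_common; case: H; constructor.
- exact: kwbar_w.
- exact: kwbar_vp.
Qed.

(** The image of [kwbar] and w̄ satisfy opposite zigzag identities with w. *)
Lemma kwbar_in_habiro :
    teq habiro_rel (subst kerler_to_habiro kwbar) (tgen Wbar).
Proof.
apply: sym; finish [rules sym (kerler_to_habiro_teq kwbar_w); wbar_zigzag_r].
Qed.

Lemma hlam_in_kerler : teq kerler_rel (subst habiro_to_kerler hlam) (tgen Lam).
Proof. exact: kwbar_lambda. Qed.

Lemma hLam_in_kerler :
    teq kerler_rel (subst habiro_to_kerler hLam) (tgen BigLam).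
Proof. finish [rules kwbar_lambda; teq_rel lam_w]. Qed.

Theorem corollary3p5p15 :
  exists F : bmfunctor Alg3K Alg3H,
    is_equivalence F /\ preserves_hopf_structure F kerler_hopf habiro_hopf.
Proof.
exists (subst_bmfunctor kerler_to_habiro_teq); split.
  exists (subst_functor habiro_to_kerler_teq); split.
    exists (fun a => @tid kerler_gen a), (fun a => @tid kerler_gen a).
    split=> *; try exact: teq_comp_idl.
    apply: teq_trans (teq_comp_idl _ _) (teq_trans _ (sym (teq_comp_idr _ _))).
    apply: subst_inverse => {}m {}n [? ? ?||];
      [exact: teq_refl | exact: hlam_in_kerler | exact: hLam_in_kerler].
  exists (fun a => @tid habiro_gen a), (fun a => @tid habiro_gen a).
  split=> *; try exact: teq_comp_idl.
  apply: teq_trans (teq_comp_idl _ _) (teq_trans _ (sym (teq_comp_idr _ _))).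
  by apply: subst_inverse => {}m {}n [? ? ?|];
    [exact: teq_refl | exact: kwbar_in_habiro].
exists erefl => /=.
split; split; finish (@nil (rule habiro_rel)).
Qed.
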